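(* Let $\Gamma$ be an infinite simple discrete group with property $(T)$. Then the topological group $b(\mathbb N,\Gamma)$ is complete, separable and minimally almost periodic, has property $(T)$ with a compact Kazhdan set, and admits no finite Kazhdan set.
   Context: $b(\mathbb N,\Gamma)$ is the group of all functions from $\mathbb N$ to $\Gamma$ having finite range, with pointwise operations. For every finite $Q\subseteq\Gamma$, the set $Q^{\mathbb N}\subseteq b(\mathbb N,\Gamma)$ is given the compact product topology ($Q$ discrete); the topology on $b(\mathbb N,\Gamma)$ is defined by declaring $F$ closed if and only if $F\cap Q^{\mathbb N}$ is closed in $Q^{\mathbb N}$ for every finite $Q\subseteq\Gamma$. (A discrete group with property $(T)$ is finitely generated, hence countable, and this is a Hausdorff group topology.) A topological group is complete if it is complete with respect to its two-sided uniformity (the supremum of the left and right uniformities). It is minimally almost periodic if it has no non-trivial continuous finite-dimensional unitary representations. A subset $Q$ of a topological group $G$ is a Kazhdan set if there is $\varepsilon>0$ such that every strongly continuous unitary representation $\pi$ of $G$ that has a unit vector $\xi$ with $\|\xi-\pi_g\xi\|<\varepsilon$ for all $g\in Q$ has an invariant unit vector. $G$ has property $(T)$ if every strongly continuous unitary representation of $G$ which for every compact $K\subseteq G$ and $\varepsilon>0$ has a unit vector $\xi$ with $\|\xi-\pi_g\xi\|<\varepsilon$ for all $g\in K$ has an invariant unit vector; equivalently, $G$ has a compact Kazhdan set. *)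

(* Defs.v *)
From HB Require Import structures.
From mathcomp Require Import all_boot all_order all_algebra.
From mathcomp Require Import sesquilinear complex.
From mathcomp Require Import all_classical all_reals all_analysis.

Set Implicit Arguments.
Unset Strict Implicit.
Unset Printing Implicit Defensive.

Import Order.TTheory GRing.Theory Num.Theory.
Import numFieldNormedType.Exports.

Local Open Scope classical_set_scope.
Local Open Scope complex_scope.
Local Open Scope ring_scope.

(* No compatibility between the group law and the topology is built in: for
   functions of finite range it is a theorem, see [topological_group]. *)
#[short(type="preTopologicalGroupType")]
HB.structure Definition PreTopologicalGroup :=
  {G of Topological G & Group G}.

#[short(type="discreteGroupType")]
HB.structure Definition DiscreteGroup :=
  {G of DiscreteTopology G & PreTopologicalGroup G}.

Definition topological_group (G : preTopologicalGroupType) : Prop :=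
  continuous (fun xy : G * G => (xy.1 * xy.2)%g) /\
  continuous (fun x : G => (x^-1)%g).

Section abstract_group.
Variable G : groupType.

Definition normal_subgroup (N : set G) : Prop :=
  [/\ N 1%g, forall x y, N x -> N y -> N (x * y)%g,
      forall x, N x -> N (x^-1)%g & forall x y, N x -> N (x ^ y)%g].

Definition simple_group : Prop :=
  (exists x : G, x <> 1%g) /\
  forall N : set G, normal_subgroup N -> N = [set 1%g] \/ N = [set: G].

End abstract_group.

Section uniformities.
Variable G : preTopologicalGroupType.

Definition left_uniformity : set_system (G * G) :=
  filter_from (nbhs (1%g : G)) (fun U => [set xy | U (xy.1^-1 * xy.2)%g]).

Definition right_uniformity : set_system (G * G) :=
  filter_from (nbhs (1%g : G)) (fun U => [set xy | U (xy.1 * xy.2^-1)%g]).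

(* The supremum of two filters is generated by the sets [A `&` B]. *)
Definition two_sided_uniformity : set_system (G * G) :=
  [set E | exists A B, [/\ left_uniformity A, right_uniformity B &
                           A `&` B `<=` E]].

(* [cauchy] and [Complete] of the library, unfolded, for this uniformity. *)
Definition complete_group : Prop :=
  forall F : set_system G, ProperFilter F ->
    (F, F) --> two_sided_uniformity -> exists x : G, F --> x.

End uniformities.

Definition separable_space (T : topologicalType) : Prop :=
  exists2 D : set T, countable D & dense D.

(* In [completeNormedModType R[i]] the norm takes its values in [R[i]]. *)
Record hilbertType (R : realType) := HilbertType {
  hilbert_sort :> completeNormedModType R[i];
  inner : {dot hilbert_sort for @Num.conj R[i]};
  sqr_norm_inner : forall x : hilbert_sort, `|x| ^+ 2 = inner x x }.

Definition finite_dimensional (R : realType) (H : hilbertType R) : Prop :=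
  exists n (e : 'I_n -> H), forall x : H,
    exists c : 'I_n -> R[i], x = \sum_(i < n) c i *: e i.

(* Each operator is onto, hence unitary, because its inverse is the operator
   of the inverse group element. *)
Record unitary_rep (R : realType) (G : preTopologicalGroupType)
    (H : hilbertType R) := UnitaryRep {
  rep_fun :> G -> H -> H;
  rep_linear : forall g, linear (rep_fun g);
  rep_inner : forall g x y, inner H (rep_fun g x) (rep_fun g y) = inner H x y;
  rep1 : forall x, rep_fun 1%g x = x;
  repM : forall g h x, rep_fun (g * h)%g x = rep_fun g (rep_fun h x);
  rep_continuous : forall x, continuous (fun g => rep_fun g x) }.

Section property_T.
Variables (R : realType) (G : preTopologicalGroupType).

Definition has_almost_invariant (H : hilbertType R) (pi : unitary_rep G H)
    (Q : set G) (eps : R) : Prop :=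
  exists2 xi : H, `|xi| = 1 & forall g, Q g -> `|xi - pi g xi| < eps%:C.

Definition has_invariant (H : hilbertType R) (pi : unitary_rep G H) : Prop :=
  exists2 xi : H, `|xi| = 1 & forall g, pi g xi = xi.

Definition kazhdan_set (Q : set G) : Prop :=
  exists2 eps : R, 0 < eps &
    forall (H : hilbertType R) (pi : unitary_rep G H),
      has_almost_invariant pi Q eps -> has_invariant pi.

Definition has_property_T : Prop :=
  forall (H : hilbertType R) (pi : unitary_rep G H),
    (forall (K : set G) (eps : R), compact K -> 0 < eps ->
       has_almost_invariant pi K eps) ->
    has_invariant pi.

Definition minimally_almost_periodic : Prop :=
  forall (H : hilbertType R) (pi : unitary_rep G H),
    finite_dimensional H -> forall g x, pi g x = x.

End property_T.

(* [bfun G] is b(nat, G). *)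
Record bfun (T : Type) := BFun {
  bfun_val :> nat -> T;
  bfun_finite : finite_set (range bfun_val) }.

Lemma bfun_val_inj (T : Type) : injective (@bfun_val T).
Proof.
move=> [f ff] [g gf] /= fg; case: _ / fg in gf *.
by congr BFun; exact: Prop_irrelevance.
Qed.

HB.instance Definition _ (T : Type) := gen_eqMixin (bfun T).
HB.instance Definition _ (T : Type) := gen_choiceMixin (bfun T).

Section bfun_group.
Variable G : groupType.
Implicit Types f g h : bfun G.

Fact bfun_one_finite : finite_set (range (fun _ : nat => 1%g : G)).
Proof. by apply: (sub_finite_set _ (finite_set1 (1%g : G))) => _ [n _ <-]. Qed.

Fact bfun_inv_finite f : finite_set (range (fun n => (f n)^-1%g)).
Proof.
have -> : range (fun n => (f n)^-1%g) = (fun x : G => x^-1%g) @` range f.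
  by rewrite image_comp.
exact: finite_image (bfun_finite f).
Qed.

Fact bfun_mul_finite f g : finite_set (range (fun n => (f n * g n)%g)).
Proof.
apply: (sub_finite_set (B := (fun p : G * G => (p.1 * p.2)%g) @`
  (range f `*` range g))).
  by move=> _ [n _ <-]; exists (f n, g n) => //; split; exists n.
by apply: finite_image; apply: finite_setX; exact: bfun_finite.
Qed.

Definition bfun_one : bfun G := BFun bfun_one_finite.
Definition bfun_inv f : bfun G := BFun (bfun_inv_finite f).
Definition bfun_mul f g : bfun G := BFun (bfun_mul_finite f g).

Fact bfun_mulA : associative bfun_mul.
Proof. by move=> f g h; apply/bfun_val_inj/funext => n /=; rewrite mulgA. Qed.

Fact bfun_mul1 : left_id bfun_one bfun_mul.
Proof. by move=> f; apply/bfun_val_inj/funext => n /=; rewrite mul1g. Qed.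

Fact bfun_mulr1 : right_id bfun_one bfun_mul.
Proof. by move=> f; apply/bfun_val_inj/funext => n /=; rewrite mulg1. Qed.

Fact bfun_mulV : left_inverse bfun_one bfun_inv bfun_mul.
Proof. by move=> f; apply/bfun_val_inj/funext => n /=; rewrite mulVg. Qed.

Fact bfun_mulrV : right_inverse bfun_one bfun_inv bfun_mul.
Proof. by move=> f; apply/bfun_val_inj/funext => n /=; rewrite mulgV. Qed.

HB.instance Definition _ := isGroup.Build (bfun G)
  bfun_mulA bfun_mul1 bfun_mulr1 bfun_mulV bfun_mulrV.

End bfun_group.

Section bfun_topology.
Variable T : choiceType.

Definition power (Q : set T) : topologicalType :=
  prod_topology (fun _ : nat => discrete_topology Q).

Fact bfun_incl_finite (Q : set T) (Qfin : finite_set Q) (f : power Q) :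
  finite_set (range (fun n => set_val (f n) : T)).
Proof. by apply: (sub_finite_set _ Qfin) => _ [n _ <-]; exact: set_valP. Qed.

Definition bfun_incl (Q : set T) (Qfin : finite_set Q) (f : power Q) : bfun T :=
  BFun (bfun_incl_finite Qfin f).

Definition bfun_closed (F : set (bfun T)) : Prop :=
  forall (Q : set T) (Qfin : finite_set Q), closed (bfun_incl Qfin @^-1` F).

Definition bfun_open : set_system (bfun T) := [set U | bfun_closed (~` U)].

Fact bfun_openT : bfun_open setT.
Proof.
by move=> Q Qfin; rewrite setCT preimage_set0; exact: closed0.
Qed.

Fact bfun_openI : setI_closed bfun_open.
Proof.
move=> A B Ao Bo Q Qfin; rewrite setCI preimage_setU.
by apply: closedU; [exact: Ao | exact: Bo].
Qed.

Fact bfun_open_bigU (I : Type) (f : I -> set (bfun T)) :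
  (forall i, bfun_open (f i)) -> bfun_open (\bigcup_i f i).
Proof.
move=> fo Q Qfin; rewrite setC_bigcup preimage_bigcap.
by apply: closed_bigI => i _; exact: fo.
Qed.

HB.instance Definition _ := isOpenTopological.Build (bfun T)
  bfun_openT bfun_openI bfun_open_bigU.

Lemma closed_bfunE (F : set (bfun T)) : closed F <-> bfun_closed F.
Proof. by rewrite -openC; split; rewrite /open/= /bfun_open/= setCK. Qed.

End bfun_topology.

HB.instance Definition _ (G : groupType) := Topological.on (bfun G).

(* Main.v *)
(* Kazhdan's property gives a finite set S and a spectral gap valid for all
   representations of Gamma: otherwise the Hilbert sum, over the finite subsets
   of Gamma, of representations on orthogonal complements of invariant vectors
   would have almost invariant vectors but no invariant one.  In the permutation
   representation on l2 of the power set of Gamma, the vector carried by <S> is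
   S-invariant, hence Gamma-invariant, so Gamma = <S> is countable.
   - A base of neighbourhoods of x in b(N, Gamma) is then given by the sets
     {f | f n = x n or h (f n) <= n for all n}, with h : Gamma -> nat arbitrary.
   - Every element of b(N, Gamma) lies in a product of finitely many commuting
     copies of Gamma.  The product of the averages over 1 and S in these copies
     contracts the complement of the joint invariants at a rate which does not
     depend on the number of factors, so that (1, S)^N is a Kazhdan set.
   - A finite set of functions agrees at two points n and m; the functions act on
     l2(Gamma) by f . g = f(n) g f(m)^-1, which fixes the Dirac vector at 1 for
     f in this set but has no invariant vector because Gamma is infinite.
   - By Malcev's argument, the coefficients of a finite-dimensional representation
     of Gamma specialize to a locally finite field; as Gamma is simple and
     infinite, the representation is trivial. *)

From HB Require Import structures.
Require Import Defs.
From mathcomp Require Import all_boot all_order all_algebra all_field.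
From mathcomp Require Import sesquilinear complex.
From mathcomp Require Import all_classical all_reals all_analysis.
From mathcomp Require Import ring lra.

Set Implicit Arguments.
Unset Strict Implicit.
Unset Printing Implicit Defensive.

Import Order.TTheory GRing.Theory Num.Theory.
Import numFieldNormedType.Exports.

Local Open Scope classical_set_scope.
Local Open Scope complex_scope.
Local Open Scope ring_scope.

(** * Specialization of finitely generated rings *)

Section extend_specialization.
Variables (P : comNzRingType) (K : fieldType) (ev : {rmorphism P -> K}) (x : K).

Definition horner_map (S : comNzRingType) (f : {rmorphism P -> S}) (t : S) :
  {rmorphism {poly P} -> S} := horner_eval t \o map_poly f.

Lemma horner_mapE (S : comNzRingType) (f : {rmorphism P -> S}) (t : S) g :
  horner_map f t g = (map_poly f g).[t].
Proof. by []. Qed.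

Local Notation evx := (horner_map ev x).
Local Notation dg g := (size (map_poly ev g)).

(** Degrees are taken after [ev]: coefficients of [w] above index [(dg w).-1] may be nonzero in [P]
    but die in [K], so the entry at that index acts as leading coefficient. Cross-multiplication
    replaces division by it. *)
Lemma pseudo_reduce (g w : {poly P}) : map_poly ev w != 0 -> (dg w <= dg g)%N ->
  exists q, (dg (w`_(dg w).-1 *: g - q * w) < dg g)%N.
Proof.
move=> w0 wg.
have dw : (0 < dg w)%N by rewrite size_poly_gt0.
have dgg : (0 < dg g)%N := leq_trans dw wg.
exists (g`_(dg g).-1 *: 'X^(dg g - dg w)).
rewrite -[X in (_ < X)%N](prednK dgg) ltnS; apply/leq_sizeP => j hj.
rewrite rmorphB rmorphM /= !map_polyZ /= map_polyXn coefB -scalerAl !coefZ coefXnM.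
have [->|jn] := eqVneq j (dg g).-1.
  rewrite ltnNge (_ : (dg g - dg w <= (dg g).-1)%N); last first.
    by rewrite -subn1 leq_sub2l.
  have -> : ((dg g).-1 - (dg g - dg w) = (dg w).-1)%N.
    by rewrite subnBA // addnC -subn1 addnBA // subnAC addnK subn1.
  by rewrite /= !coef_map mulrC subrr.
have {}hj : (dg g <= j)%N.
  by rewrite -(prednK dgg) ltn_neqAle eq_sym jn.
rewrite [X in _ * X](nth_default _ hj) mulr0 sub0r.
case: ltnP => [_|]; first by rewrite mulr0 oppr0.
move=> hj'; rewrite [X in _ * X]nth_default ?mulr0 ?oppr0 //.
by rewrite leq_subRL // subnK // (leq_trans _ hj).
Qed.

Lemma ev_lead_neq0 (w : {poly P}) : map_poly ev w != 0 -> ev w`_(dg w).-1 != 0.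
Proof. by move=> w0; rewrite -coef_map -lead_coefE lead_coef_eq0. Qed.

Lemma pseudo_division (f w : {poly P}) : map_poly ev w != 0 ->
  exists a q r, [/\ ev a != 0, a *: f = q * w + r & (dg r < dg w)%N].
Proof.
move=> w0; have [n] := ubnP (dg f); elim: n f => // n IH f.
rewrite ltnS => fn; have [fw|wf] := ltnP (dg f) (dg w).
  by exists 1, 0, f; rewrite rmorph1 oner_eq0 scale1r mul0r add0r.
have [q hq] := pseudo_reduce w0 wf.
have [a [q' [r [a0 e hr]]]] := IH _ (leq_trans hq fn).
exists (a * w`_(dg w).-1), (q' + a *: q), r; split => //.
  by rewrite rmorphM mulf_neq0 // ev_lead_neq0.
by rewrite mulrDl addrAC -e scalerBr scalerA -scalerAl subrK.
Qed.

(** The extension step for homomorphisms into algebraically closed fields. The subring of [K]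
    generated so far is represented as a quotient of [P], hence the condition that [psi] kill the
    kernel of [ev]; [a] is the obstruction to extending [psi] while [b] survives. *)
Lemma extend_specialization (b : {poly P}) : evx b != 0 ->
  exists2 a, ev a != 0 & forall (L : closedFieldType) (psi : {rmorphism P -> L}),
    (forall c, ev c = 0 -> psi c = 0) -> psi a != 0 ->
  exists2 t : L, (forall g, evx g = 0 -> horner_map psi t g = 0) &
    horner_map psi t b != 0.
Proof.
move=> b0.
have Phi0 g : evx g != 0 -> map_poly ev g != 0.
  by apply: contraNneq; rewrite horner_mapE => ->; rewrite horner0.
have killed (L : closedFieldType) (psi : {rmorphism P -> L}) :
    (forall c, ev c = 0 -> psi c = 0) ->
    forall g, map_poly ev g = 0 -> map_poly psi g = 0.
  move=> kpsi g g0; apply/polyP => i; rewrite coef_map coef0 /=.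
  by apply: kpsi; rewrite -coef_map g0 coef0.
(* Either [x] is algebraic over the fraction field of the image of [ev], or it is transcendental. In
   the latter case, treated first, a relation of [x] has all coefficients killed by [ev], and any
   [t] that is not a root of the image of [b] will do. *)
have [[f [f0 fx]]|/forallNP tr] :=
    pselect (exists f, map_poly ev f != 0 /\ evx f = 0); last first.
  exists b`_(dg b).-1; first exact/ev_lead_neq0/Phi0.
  move=> L psi kpsi psi0; pose p := map_poly psi b.
  have p0 : p != 0.
    by apply: contraNneq psi0 => p0; rewrite -coef_map -/p p0 coef0.
  (* A root of [p + 1] is a point where [p] is -1; if [p + 1] is a nonzero constant, then [p] is
     constant, and it is nonzero. *)
  have [t pt] : exists t, p.[t] != 0.
    have [p1|/closed_rootP[t]] := eqVneq (size (p + 1)) 1%N; last first.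
      rewrite /root hornerD hornerC addr_eq0 => /eqP pt; exists t.
      by rewrite pt oppr_eq0 oner_eq0.
    exists 0; rewrite horner_coef0.
    have /size_poly1P[c c0 pc] : size (p + 1) == 1%N by rewrite p1.
    have {}pc : p = (c - 1)%:P by rewrite polyCB -pc addrK.
    by move: p0; rewrite pc polyC_eq0 coefC.
  exists t => // g gx; rewrite horner_mapE (killed _ _ kpsi) ?horner0 //.
  by apply/eqP; apply: contrapT => /negP g0; apply: (tr g).
have {f f0 fx} [f [f0 fx fmin]] : exists f, [/\ map_poly ev f != 0, evx f = 0 &
    forall g, evx g = 0 -> (dg g < dg f)%N -> map_poly ev g = 0].
  pose A n := `[< exists f, [/\ map_poly ev f != 0, evx f = 0 & dg f = n] >].
  have exA : exists n, A n by exists (dg f); apply/asboolP; exists f.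
  case: (ex_minnP exA) => m /asboolP[g [g0 gx <-]] gmin.
  exists g; split=> // h hx hg; apply: contrapT => /eqP h0.
  have /gmin : A (dg h) by apply/asboolP; exists h.
  by rewrite leqNgt hg.
(* Some multiple of [b] has at [x] a nonzero value in the image of [ev]. Take [w] of least degree
   with such a value. If [w] is not constant, the remainder of [f] by [w] vanishes at [x] by
   minimality of [w], hence is 0 by minimality of [f]; then the quotient is a relation of [x] of
   smaller degree than [f]. *)
have [a [v [a0 av]]] : exists a v, ev a != 0 /\ evx (v * b) = ev a.
  pose A n := `[< exists w v, [/\ evx w != 0, evx w = evx (v * b) & dg w = n] >].
  have exA : exists n, A n.
    by exists (dg b); apply/asboolP; exists b, 1; rewrite mul1r.
  case: (ex_minnP exA) => m /asboolP[w [v [w0 wv wm]]] wmin.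
  have {}wmin w' v' : evx w' != 0 -> evx w' = evx (v' * b) -> (dg w <= dg w')%N.
    by move=> ? ?; rewrite wm; apply: wmin; apply/asboolP; exists w', v'.
  have w1 := Phi0 _ w0.
  have [dw1|dw1] := leqP (dg w) 1.
    have wc : map_poly ev w = (ev w`_0)%:P.
      by rewrite [LHS]size1_polyC // coef_map.
    have wx : evx w = ev w`_0 by rewrite horner_mapE wc hornerC.
    by exists w`_0, v; rewrite -wv -wx.
  exfalso; have dwf : (dg w < dg f)%N.
    rewrite ltnNge; apply/negP => /(pseudo_reduce f0)[q hq].
    have e : evx (f`_(dg f).-1 *: w - q * f) = ev f`_(dg f).-1 * evx w.
      by rewrite rmorphB rmorphM fx mulr0 subr0 [LHS]horner_mapE map_polyZ hornerZ.
    have h1 : evx (f`_(dg f).-1 *: w - q * f) != 0.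
      by rewrite e mulf_neq0 // ev_lead_neq0.
    have h2 : evx (f`_(dg f).-1 *: w - q * f) = evx ((f`_(dg f).-1 *: v) * b).
      by rewrite e wv -scalerAl [RHS]horner_mapE map_polyZ hornerZ.
    have := wmin _ _ h1 h2.
    by rewrite leqNgt hq.
  have [a [q [r [a0 e hr]]]] := pseudo_division f w1.
  have rx : evx r = 0.
    apply: contrapT => /eqP r0; have h2 : evx r = evx (- q * v * b).
      have : evx (a *: f) = 0.
        by rewrite horner_mapE map_polyZ hornerZ -horner_mapE fx mulr0.
      rewrite e (rmorphD evx) (rmorphM evx) wv => /eqP; rewrite addrC addr_eq0 => /eqP ->.
      by rewrite !mulNr (rmorphN evx) -mulrA !(rmorphM evx).
    by have := wmin r (- q * v) r0 h2; rewrite leqNgt hr.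
  have r0 := fmin r rx (ltn_trans hr dwf).
  have e2 : ev a *: map_poly ev f = map_poly ev q * map_poly ev w.
    by rewrite -map_polyZ e rmorphD rmorphM /= r0 addr0.
  have q0 : map_poly ev q != 0.
    apply/eqP => q0; move/eqP: e2; rewrite q0 mul0r scale_poly_eq0.
    by rewrite (negbTE a0) (negbTE f0).
  have qx : evx q = 0.
    have : evx q * evx w = 0.
      rewrite !horner_mapE -hornerM -e2 hornerZ.
      by have := fx; rewrite horner_mapE => ->; rewrite mulr0.
    by move/eqP; rewrite mulf_eq0 (negbTE w0) orbF => /eqP.
  suff : (dg q < dg f)%N by move/(fmin q qx)/eqP; rewrite (negbTE q0).
  have : dg f = size (ev a *: map_poly ev f) by rewrite size_scale.
  rewrite e2 size_mul // => ->; case: (dg w) dw1 => // -[|n] // _.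
  by rewrite !addnS ltnS leq_addr.
(* The factor [a] keeps [b] alive. The other factor makes the image of [f] nonconstant, so that it
   has a root [t], and cancels the multipliers in the pseudo-division by [f] showing that [t]
   satisfies every relation of [x]. *)
exists (a * f`_(dg f).-1); first by rewrite rmorphM mulf_neq0 // ev_lead_neq0.
move=> L psi kpsi; rewrite rmorphM mulf_eq0 negb_or => /andP[psia psif].
have dgf : (1 < dg f)%N.
  rewrite ltnNge; apply/negP => /size1_polyC e; move: fx f0.
  by rewrite horner_mapE e hornerC => ->; rewrite eqxx.
have [|t tf] := closed_rootP (map_poly psi f) _.
  apply/negP => /eqP sf; move: psif; rewrite -coef_map nth_default ?eqxx // sf.
  by rewrite -ltnS prednK // ltnW.
have kt g : evx g = 0 -> horner_map psi t g = 0.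
  have [n] := ubnP (dg g); elim: n g => // n IH g; rewrite ltnS => gn gx.
  have [gf|fg] := ltnP (dg g) (dg f).
    by rewrite horner_mapE (killed _ _ kpsi) ?horner0 //; exact: fmin.
  have [q hq] := pseudo_reduce f0 fg.
  have e1 : evx (f`_(dg f).-1 *: g - q * f) = 0.
    rewrite (rmorphB evx) (rmorphM evx) fx mulr0 subr0 [LHS]horner_mapE map_polyZ.
    by rewrite hornerZ -horner_mapE gx mulr0.
  have := IH _ (leq_trans hq gn) e1.
  rewrite (rmorphB (horner_map psi t)) (rmorphM (horner_map psi t)).
  rewrite [X in _ * X]horner_mapE (eqP tf) mulr0 subr0.
  rewrite (horner_mapE psi t (_ *: _)) map_polyZ hornerZ.
  by move/eqP; rewrite mulf_eq0 (negbTE psif) => /eqP.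
exists t => //.
have : horner_map psi t (v * b - a%:P) = 0.
  by apply: kt; rewrite rmorphB av horner_mapE map_polyC hornerC subrr.
rewrite rmorphB [X in _ - X]horner_mapE map_polyC hornerC rmorphM /=.
move/eqP; rewrite subr_eq0 => /eqP e; apply: contraNneq psia => b1.
by rewrite -e b1 mulr0.
Qed.

End extend_specialization.

(** [P] is an iterated polynomial ring over the integers, with one variable per entry of [s].
    Induction pushes the obstruction down to an integer, nonzero because [K] has characteristic
    0. *)
Lemma specialization (K : numFieldType) (s : seq K) :
  exists (P : comNzRingType) (ev : {rmorphism P -> K}),
    (forall z, z \in s -> exists c, ev c = z) /\
    forall b, ev b != 0 -> exists2 a : int, a != 0 &
      forall L : closedFieldType, a%:~R != 0 :> L ->
      exists2 psi : {rmorphism P -> L},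
        forall c, ev c = 0 -> psi c = 0 & psi b != 0.
Proof.
elim: s => [|x s [P [ev [evs spec]]]].
  exists int, (intr : {rmorphism int -> K}); split => // b b0.
  exists b; first by move: b0; rewrite intr_eq0.
  move=> L bL; exists (intr : {rmorphism int -> L}) => // c.
  by move/eqP; rewrite intr_eq0 => /eqP ->; rewrite rmorph0.
exists {poly P}, (horner_map ev x); split=> [z|b b0].
  rewrite inE => /predU1P[->|/evs[c <-]].
    by exists 'X; rewrite horner_mapE map_polyX hornerX.
  by exists c%:P; rewrite horner_mapE map_polyC hornerC.
have [c c0 ext] := extend_specialization b0.
have [a a0 spa] := spec c c0; exists a => // L aL.
have [psi kpsi psic] := spa L aL; have [t kt tb] := ext L psi kpsi psic.
by exists (horner_map psi t).
Qed.

(** The residues of [X^(p^k)] modulo an equation of [y] lie in a finite set, so two of the powers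
    [y^(p^k)] coincide; injectivity of Frobenius cancels the smaller exponent. *)
Lemma frobenius_fixed (p : nat) (L : fieldType) (FtoL : {rmorphism 'F_p -> L})
    (y : L) : prime p -> integralOver FtoL y ->
  exists2 m, (0 < m)%N & y ^+ (p ^ m) = y.
Proof.
move=> p_pr [f fmon /rootP fy].
have pL : p \in [pchar L] by rewrite (fmorph_pchar FtoL) pchar_Fp.
have f0 := monic_neq0 fmon.
(* One exponent more than there are coefficient rows of length [size f], in which the residues
   modulo [f] are stored. *)
pose e (i : 'I_(#|'rV['F_p]_(size f)|).+1) : 'rV['F_p]_(size f) :=
  poly_rV ('X^(p ^ i) %% f).
have /injectivePn[i [j ij]] : ~~ injectiveb e.
  by apply/injectiveP => /leq_card; rewrite card_ord ltnn.
move=> eij; wlog ltij : i j ij eij / (i < j)%N.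
  move=> H; have [ij'|] := ltnP i j; first exact: (H i j).
  rewrite leq_eqVlt => /orP[/eqP/val_inj ji|]; first by rewrite ji eqxx in ij.
  by apply: (H j i); rewrite // eq_sym.
have modE k : (map_poly FtoL ('X^k %% f)).[y] = y ^+ k.
  rewrite -[RHS]hornerXn -(map_polyXn FtoL) [in RHS](divp_eq 'X^k f).
  by rewrite rmorphD rmorphM hornerD hornerM fy mulr0 add0r.
have {}eij : 'X^(p ^ i) %% f = 'X^(p ^ j) %% f.
  have sz k : (size ('X^k %% f)%R <= size f)%N by rewrite ltnW // ltn_modp.
  by rewrite -(poly_rV_K (sz (p ^ i)%N)) -(poly_rV_K (sz (p ^ j)%N)); congr rVpoly.
have {eij modE} yij : y ^+ (p ^ i) = y ^+ (p ^ j) by rewrite -!modE eij.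
exists (j - i)%N; first by rewrite subn_gt0.
have inj : injective (fun z : L => z ^+ (p ^ i)).
  move=> u v uv; apply/eqP; rewrite -subr_eq0; apply/eqP.
  suff: (u - v) ^+ (p ^ i) = 0 by move/eqP; rewrite expf_eq0 => /andP[_ /eqP].
  apply: (@addIr _ (v ^+ (p ^ i))).
  by rewrite -exprDn_pchar ?subrK ?add0r // pnatX pnatE ?pL.
by apply: inj; rewrite /= -exprM -expnD subnK // ltnW.
Qed.

(** Finitely many algebraic elements are fixed by a common power of Frobenius; [T] lists all fixed
    points of that power, the roots of [X^(p^m) - X]. *)
Lemma finite_subring_closure (p : nat) (L : closedFieldType)
    (FtoL : {rmorphism 'F_p -> L}) (ys : seq L) : prime p ->
    integralRange FtoL ->
  exists T : seq L, {subset ys <= T} /\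
    forall u v, u \in T -> v \in T -> u + v \in T /\ u * v \in T.
Proof.
move=> p_pr int.
have pL : p \in [pchar L] by rewrite (fmorph_pchar FtoL) pchar_Fp.
have [m m0 ysm] : exists2 m, (0 < m)%N & forall y, y \in ys -> y ^+ (p ^ m) = y.
  elim: ys => [|y ys [m m0 ysm]]; first by exists 1%N.
  have [k k0 yk] := frobenius_fixed p_pr (int y).
  have per z l n : z ^+ (p ^ l) = z -> z ^+ (p ^ (n * l)) = z.
    by move=> zl; elim: n => // n IH; rewrite mulSn expnD exprM zl.
  exists (k * m)%N; first by rewrite muln_gt0 k0.
  move=> z; rewrite inE => /predU1P[->|/ysm zm]; last exact: per.
  by rewrite mulnC; exact: per.
have q1 : (1 < p ^ m)%N by rewrite -(exp1n m) ltn_exp2r // prime_gt1.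
pose f : {poly L} := 'X^(p ^ m) - 'X.
have f0 : f != 0.
  rewrite -size_poly_gt0 size_polyDl ?size_polyXn // size_polyN size_polyX.
  by rewrite ltnS.
have [T fT] := closed_field_poly_normal f.
have inT z : (z \in T) = (z ^+ (p ^ m) == z).
  rewrite -root_prod_XsubC -(rootZ _ _ (a := lead_coef f)) ?lead_coef_eq0 //.
  by rewrite -fT /root !hornerE subr_eq0.
exists T; split=> [y /ysm yq|u v]; first by rewrite inT yq.
rewrite (inT u) (inT v) => /eqP um /eqP vm.
rewrite (inT (u + v)) (inT (u * v)) exprMn um vm; split=> //.
by rewrite exprDn_pchar ?um ?vm // pnatX pnatE ?pL.
Qed.

(** [L] is an algebraic closure of [F_p] for a prime [p] exceeding [|a|], so that the integer
    obstruction [a] stays nonzero in it. *)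
Lemma locally_finite_specialization (K : numFieldType) (s : seq K) :
  exists (P : comNzRingType) (ev : {rmorphism P -> K}),
    (forall z, z \in s -> exists c, ev c = z) /\
    forall b, ev b != 0 ->
      exists (L : fieldType) (psi : {rmorphism P -> L}),
      [/\ forall c, ev c = 0 -> psi c = 0, psi b != 0 &
        forall ys : seq L, exists T : seq L, {subset ys <= T} /\
          forall u v, u \in T -> v \in T -> u + v \in T /\ u * v \in T].
Proof.
have [P [ev [evs spec]]] := specialization s.
exists P, ev; split => // b /spec[a a0 spa].
have [p pa p_pr] := prime_above `|a|%N.
have [L [FtoL intL]] := countable_algebraic_closure 'F_p.
have pL : p \in [pchar L] by rewrite (fmorph_pchar FtoL) pchar_Fp.
have [|psi kpsi psib] := spa L.
  suff : `|a|%N%:R != 0 :> L.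
    have [->//|->] : `|a|%N%:R = a%:~R :> L \/ `|a|%N%:R = - a%:~R :> L.
      by case: (a) => n; [left | right; rewrite NegzE rmorphN opprK].
    by rewrite oppr_eq0.
  by rewrite -(dvdn_pcharf pL) gtnNdvd // absz_gt0.
exists L, psi; split => // ys; exact: finite_subring_closure p_pr intL.
Qed.

(** * Finitely generated simple linear groups *)

Definition generated_by (G : groupType) (S : set G) : Prop :=
  forall D : set G, D 1%g ->
    (forall s g, S s -> D g -> D (s * g)%g /\ D (s^-1 * g)%g) -> forall g, D g.

(** If [rho g0] is not 1, some entry of [rho g0 - 1] survives a specialization into a locally finite
    field. The kernel [N] of the specialized representation misses [g0], hence is trivial by
    simplicity; but the specialized matrices have entries in a finite set, so [G] would be
    finite. *)
Lemma simple_linear_trivial (K : numFieldType) (G : groupType) (S : seq G)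
    (n : nat) (rho : G -> 'M[K]_n) :
  infinite_set [set: G] -> simple_group G -> generated_by [set` S] ->
  rho 1%g = 1%:M -> (forall g h, rho (g * h)%g = rho g *m rho h) ->
  forall g, rho g = 1%:M.
Proof.
move=> Ginf [_ Gsimple] gen rho1 rhoM.
pose entries (A : 'M[K]_n) := [seq A ij.1 ij.2 | ij : 'I_n * 'I_n].
pose s := flatten [seq entries (rho x) ++ entries (rho x^-1%g) | x <- S].
have [P [ev [evs spec]]] := locally_finite_specialization s.
have lift x : x \in S \/ x^-1%g \in S -> exists M, map_mx ev M = rho x.
  move=> xS; suff /choice[c cE] : forall ij : 'I_n * 'I_n,
    exists c, ev c = rho x ij.1 ij.2.
    by exists (\matrix_(i, j) c (i, j)); apply/matrixP => i j; rewrite !mxE cE.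
  move=> ij; apply: evs; apply/flattenP; case: xS => xS.
    exists (entries (rho x) ++ entries (rho x^-1%g)); first exact: map_f.
    by rewrite mem_cat (map_f (fun ij => rho x ij.1 ij.2)) // mem_enum.
  exists (entries (rho x^-1%g) ++ entries (rho x)).
    by apply/mapP; exists x^-1%g; rewrite ?invgK.
  by rewrite mem_cat orbC (map_f (fun ij => rho x ij.1 ij.2)) // mem_enum.
(* [m] lifts the generators and their inverses to matrices over [P]; 0 is only a dummy witness for
   other elements. *)
have /choice[m mE] : forall x, exists M, x \in S \/ x^-1%g \in S -> map_mx ev M = rho x.
  move=> x; have [/lift[M ME]|nxS] := pselect (x \in S \/ x^-1%g \in S).
    by exists M.
  by exists 0.
have liftG (g : G) : exists M, map_mx ev M = rho g.
  move: g; apply: gen => [|x g xS [M ME]]; first by exists 1%:M; rewrite map_mx1.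
  split; [exists (m x *m M) | exists (m x^-1%g *m M)].
    by rewrite map_mxM /= mE ?ME ?rhoM //; left.
  by rewrite map_mxM /= mE ?ME ?rhoM //; right; rewrite invgK.
move=> g0; apply: contrapT => g0n1.
have [M0 M0E] := liftG g0.
have [b [b0 bE]] : exists b, ev b != 0 /\ exists i j, b = (M0 - 1%:M) i j.
  apply: contrapT => nob; apply: g0n1; apply/matrixP => i j.
  apply/eqP; rewrite -subr_eq0; apply/negP => /negP h; apply: nob.
  exists ((M0 - 1%:M) i j); split; last by exists i, j.
  by rewrite !mxE rmorphB rmorphMn rmorph1; rewrite -M0E !mxE in h.
have [L [psi [kpsi psib locfin]]] := spec b b0.
(* The specialization of a lift depends only on its image under [ev], so membership in [N] can be
   tested on any lift. *)
have kpsiM (A B : 'M[P]_n) : map_mx ev A = map_mx ev B -> map_mx psi A = map_mx psi B.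
  move=> /matrixP AB; apply/matrixP => i j; rewrite !mxE.
  apply/eqP; rewrite -subr_eq0 -rmorphB; apply/eqP/kpsi.
  by have := AB i j; rewrite !mxE rmorphB => ->; rewrite subrr.
pose N : set G := [set g | exists2 M, map_mx ev M = rho g & map_mx psi M = 1%:M].
have NE g M : map_mx ev M = rho g -> N g <-> map_mx psi M = 1%:M.
  move=> ME; split=> [[M' M'E <-]|]; last by exists M.
  by apply: kpsiM; rewrite ME.
have Nnormal : normal_subgroup N.
  split.
  - by exists 1%:M; rewrite ?map_mx1.
  - move=> x y [M ME M1] [M' M'E M'1]; exists (M *m M').
      by rewrite map_mxM /= ME M'E rhoM.
    by rewrite map_mxM /= M1 M'1 mulmx1.
  - move=> x [M ME M1]; have [M' M'E] := liftG x^-1%g; exists M' => //.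
    transitivity (map_mx psi (M *m M')); first by rewrite map_mxM /= M1 mul1mx.
    rewrite -[RHS](map_mx1 psi); apply: kpsiM.
    by rewrite map_mxM /= ME M'E -rhoM mulgV rho1 map_mx1.
  - move=> x y [M ME M1]; have [A AE] := liftG y; have [B BE] := liftG y^-1%g.
    exists (B *m M *m A).
      by rewrite !map_mxM /= ME AE BE conjgE !rhoM mulmxA.
    rewrite !map_mxM /= M1 mulmx1 -map_mxM -[RHS](map_mx1 psi); apply: kpsiM.
    by rewrite map_mxM /= AE BE -rhoM mulVg rho1 map_mx1.
have [N1|NT] := Gsimple N Nnormal; last first.
  have /(NE _ _ M0E) M01 : N g0 by rewrite NT.
  case: bE => i [j bE]; move: psib; rewrite bE !mxE rmorphB.
  by have /matrixP/(_ i j) := M01; rewrite !mxE => ->; rewrite rmorphMn rmorph1 subrr eqxx.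
(* 0 starts the sums in matrix products and 0 and 1 fill the identity matrix. Since inverses of
   generators are listed too, closure under sums and products confines the whole group to entries in
   [T]. *)
pose ys := 0 :: 1 :: flatten [seq [seq psi (m x ij.1 ij.2) | ij : 'I_n * 'I_n] ++
   [seq psi (m (x^-1)%g ij.1 ij.2) | ij : 'I_n * 'I_n] | x <- S].
have [T [ysT Tring]] := locfin ys.
have T0 : 0 \in T by apply: ysT; rewrite inE eqxx.
have T1 : 1 \in T by apply: ysT; rewrite !inE eqxx orbT.
have TM (A B : 'M[L]_n) : (forall i j, A i j \in T) -> (forall i j, B i j \in T) ->
    forall i j, (A *m B) i j \in T.
  move=> AT BT i j; rewrite mxE; elim/big_ind: _ => // [u v uT vT|k _].
    by have [] := Tring u v uT vT.
  by have [] := Tring _ _ (AT i k) (BT k j).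
have mT x : x \in S -> (forall i j, psi (m x i j) \in T) /\
    (forall i j, psi (m (x^-1)%g i j) \in T).
  move=> xS; split=> i j; apply: ysT; rewrite !inE; apply/orP; right; apply/orP; right;
    apply/flattenP;
    exists ([seq psi (m x ij.1 ij.2) | ij : 'I_n * 'I_n] ++
      [seq psi (m (x^-1)%g ij.1 ij.2) | ij : 'I_n * 'I_n]); try exact: map_f.
  - by rewrite mem_cat (map_f (fun ij => psi (m x ij.1 ij.2)) (x := (i, j))) // mem_enum.
  - rewrite mem_cat orbC.
    by rewrite (map_f (fun ij => psi (m (x^-1)%g ij.1 ij.2)) (x := (i, j))) // mem_enum.
have liftT (g : G) : exists M, map_mx ev M = rho g /\ forall i j, map_mx psi M i j \in T.
  move: g; apply: gen => [|x g xS [M [ME MT]]].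
    by exists 1%:M; rewrite !map_mx1; split=> // i j; rewrite mxE; case: (i == j).
  have [xT xVT] := mT x xS.
  split; [exists (m x *m M) | exists (m x^-1%g *m M)]; split.
  - by rewrite map_mxM /= mE ?ME ?rhoM //; left.
  - by rewrite map_mxM; apply: TM => // i j; rewrite mxE.
  - by rewrite map_mxM /= mE ?ME ?rhoM //; right; rewrite invgK.
  - by rewrite map_mxM; apply: TM => // i j; rewrite mxE.
have [M ME] := choice liftT.
apply: Ginf; pose F := [set` {: {ffun 'I_n * 'I_n -> seq_sub T}}].
pose c g : {ffun 'I_n * 'I_n -> seq_sub T} :=
  [ffun ij => SeqSub ((ME g).2 ij.1 ij.2)].
have cinj : injective c.
  move=> g h /ffunP gh; have psigh : map_mx psi (M g) = map_mx psi (M h).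
    by apply/matrixP => i j; have := congr1 val (gh (i, j)); rewrite !ffunE.
  have : N (g * h^-1)%g.
    have [M' M'E] := liftG h^-1%g.
    exists (M g *m M'); first by rewrite map_mxM /= (ME g).1 M'E rhoM.
    rewrite map_mxM /= psigh -map_mxM -[RHS](map_mx1 psi); apply: kpsiM.
    by rewrite map_mxM /= (ME h).1 M'E -rhoM mulgV rho1 map_mx1.
  by rewrite N1 => /= e; rewrite -[g](mulgVK h) e mul1g.
have cfin : finite_set (c @` [set: G]).
  exact: finite_finset.
have : (c @` [set: G] #= [set: G])%card by apply: inj_card_eq => x y _ _; exact: cinj.
by move/eq_finite_set => <-.
Qed.

(** * Hilbert spaces through the real part of the inner product *)

Lemma ReD (R : rcfType) (x y : R[i]) : complex.Re (x + y) = complex.Re x + complex.Re y.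
Proof. by case: x y => [a b] []. Qed.

Lemma ReN (R : rcfType) (x : R[i]) : complex.Re (- x) = - complex.Re x.
Proof. by case: x. Qed.

Lemma ReZ (R : rcfType) (r : R) (x : R[i]) : complex.Re (r%:C * x) = r * complex.Re x.
Proof. by case: x => a b /=; rewrite mul0r subr0. Qed.

Lemma Re_conj (R : rcfType) (x : R[i]) : complex.Re (Num.conj x) = complex.Re x.
Proof. by case: x. Qed.

Section hilbert.
Variables (R : realType) (H : hilbertType R).
Implicit Types (x y z : H) (C : set H).

(** The norm of [H] is [R[i]]-valued; its real part lets all estimates take place in the ordered
    field [R]. *)
Definition nrm x : R := complex.Re `|x|.
Definition rip x y : R := complex.Re (inner H x y).

Lemma nrmE x : `|x| = (nrm x)%:C.
Proof. by rewrite /nrm RRe_real // ger0_real. Qed.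

Lemma nrm_ge0 x : 0 <= nrm x.
Proof. by rewrite -ler0c -nrmE. Qed.

Lemma nrm0 : nrm 0 = 0.
Proof. by rewrite /nrm normr0. Qed.

Lemma nrm0_eq0 x : nrm x = 0 -> x = 0.
Proof. by move=> x0; apply/normr0_eq0; rewrite nrmE x0. Qed.

Lemma nrmN x : nrm (- x) = nrm x.
Proof. by rewrite /nrm normrN. Qed.

Lemma nrmB x y : nrm (x - y) = nrm (y - x).
Proof. by rewrite -nrmN opprB. Qed.

Lemma ler_nrmD x y : nrm (x + y) <= nrm x + nrm y.
Proof.
have := ler_normD x y; rewrite !nrmE -rmorphD /= lecE /= => /andP[_].
exact.
Qed.

Lemma nrmZ (r : R) x : nrm (r%:C *: x) = `|r| * nrm x.
Proof.
by rewrite /nrm normrZ normc_def /= expr0n addr0 sqrtr_sqr ReZ.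
Qed.

Lemma ripC x y : rip x y = rip y x.
Proof. by rewrite /rip (hermC (inner H)) /= expr0 mul1r Re_conj. Qed.

Lemma ripDl x y z : rip (x + y) z = rip x z + rip y z.
Proof. by rewrite /rip linearDl ReD. Qed.

Lemma ripNl x y : rip (- x) y = - rip x y.
Proof. by rewrite /rip linearNl ReN. Qed.

Lemma ripZl (r : R) x y : rip (r%:C *: x) y = r * rip x y.
Proof. by rewrite /rip linearZl_LR /= ReZ. Qed.

Lemma ripDr x y z : rip x (y + z) = rip x y + rip x z.
Proof. by rewrite ripC ripDl !(ripC x). Qed.

Lemma ripNr x y : rip x (- y) = - rip x y.
Proof. by rewrite ripC ripNl ripC. Qed.

Lemma ripZr (r : R) x y : rip x (r%:C *: y) = r * rip x y.
Proof. by rewrite ripC ripZl ripC. Qed.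

Lemma ripxx x : rip x x = nrm x ^+ 2.
Proof. by rewrite /rip -sqr_norm_inner nrmE -rmorphXn. Qed.

Lemma sqr_nrmD x y : nrm (x + y) ^+ 2 = nrm x ^+ 2 + nrm y ^+ 2 + 2 * rip x y.
Proof. by rewrite -!ripxx ripDl !ripDr (ripC y x); ring. Qed.

Lemma sqr_nrmB x y : nrm (x - y) ^+ 2 = nrm x ^+ 2 + nrm y ^+ 2 - 2 * rip x y.
Proof. by rewrite sqr_nrmD nrmN ripNr; ring. Qed.

(** The parallelogram law, arranged to show how much shorter a midpoint is than its two ends in
    quadratic mean. *)
Lemma nrm_half x y :
  nrm (2^-1%:C *: (x + y)) ^+ 2 =
  (nrm x ^+ 2 + nrm y ^+ 2) / 2 - nrm (x - y) ^+ 2 / 4.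
Proof.
rewrite nrmZ exprMn (sqr_nrmD x y) (sqr_nrmB x y) ger0_norm ?invr_ge0 //; by field.
Qed.

Definition nclosed C := forall x,
  (forall e : R, 0 < e -> exists2 y, C y & nrm (x - y) < e) -> C x.

Lemma nbhs_nrm x (U : set H) :
  nbhs x U <-> exists2 e : R, 0 < e & [set y | nrm (x - y) < e] `<=` U.
Proof.
split=> [/nbhs_ballP[e /= e0 eU]|[e e0 eU]].
  have eE : e = (complex.Re e)%:C by rewrite RRe_real // gtr0_real.
  exists (complex.Re e); first by rewrite -ltcR -eE.
  move=> y xy; apply: eU; rewrite -ball_normE /ball_ /= nrmE eE ltcR.
  exact: xy.
apply/nbhs_ballP; exists e%:C => /=; first by rewrite ltcR.
by move=> y; rewrite -ball_normE /ball_ /= nrmE ltcR => /eU.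
Qed.

Lemma nrm_complete (F : set_system H) : ProperFilter F ->
  (forall e : R, 0 < e -> exists x, F [set y | nrm (x - y) < e]) ->
  exists x, forall e : R, 0 < e -> F [set y | nrm (x - y) < e].
Proof.
move=> FF Fc; have /cauchy_cvg/cvg_ex[x Fx] : cauchy F.
  apply: cauchy_exP => e e0.
  have eE : e = (complex.Re e)%:C by rewrite RRe_real // gtr0_real.
  have [|x Fx] := Fc (complex.Re e); first by rewrite -ltcR -eE.
  exists x; apply: filterS Fx => y /=; rewrite -ball_normE /ball_ /= nrmE => xy.
  by rewrite eE ltcR.
exists x => e e0; apply: Fx; apply/nbhs_nrm; by exists e.
Qed.

Lemma min_nrm_uniq C v w : (forall x y, C x -> C y -> C (2^-1%:C *: (x + y))) ->
  C v -> C w -> (forall u, C u -> nrm v <= nrm u) ->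
  (forall u, C u -> nrm w <= nrm u) -> v = w.
Proof.
move=> Cmid Cv Cw vmin wmin.
have vw : nrm v = nrm w by apply/le_anti; rewrite vmin ?wmin.
have := vmin _ (Cmid _ _ Cv Cw).
rewrite -ler_sqr ?nnegrE ?nrm_ge0 // nrm_half -vw => h.
apply/eqP; rewrite -subr_eq0; apply/eqP/nrm0_eq0/eqP.
rewrite -sqrf_eq0 eq_le sqr_ge0 andbT; lra.
Qed.

(** By the parallelogram law two vectors of [C] with almost minimal norm are close to each other, so
    the sets [B e] generate a Cauchy filter; its limit is the minimiser. *)
Lemma min_nrm C : C !=set0 ->
  (forall x y, C x -> C y -> C (2^-1%:C *: (x + y))) -> nclosed C ->
  exists2 v, C v & forall u, C u -> nrm v <= nrm u.
Proof.
move=> [c0 Cc0] Cmid Ccl.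
pose E := [set nrm u ^+ 2 | u in C]; pose d := inf E.
have Einf : has_inf E.
  by split; [exists (nrm c0 ^+ 2), c0 | exists 0 => _ [u _ <-]; exact: sqr_ge0].
have dle u : C u -> d <= nrm u ^+ 2.
  by move=> Cu; apply: ge_inf; [exact: Einf.2 | exists u].
pose B (e : R) := [set u | C u /\ nrm u ^+ 2 < d + e].
have B0 e : 0 < e -> B e !=set0.
  move=> e0; have [_ [u Cu <-] ue] := inf_adherent e0 Einf.
  by exists u.
have Bdist e u v : B e u -> B e v -> nrm (u - v) ^+ 2 < 4 * e.
  move=> [Cu ue] [Cv ve]; have := dle _ (Cmid _ _ Cu Cv).
  by rewrite nrm_half; lra.
pose F := filter_from [set e : R | 0 < e] B.
have FF : ProperFilter F.
  apply: filter_from_proper => [|e /B0//].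
  apply: filter_from_filter; first by exists 1; rewrite /= ltr01.
  move=> e e' /= e0 e'0; exists (Num.min e e'); first by rewrite /= lt_min e0.
  move=> u [Cu]; rewrite -ltrBlDl lt_min => /andP[h1 h2].
  by split; split=> //; rewrite -ltrBlDl.
have [|v Fv] := nrm_complete FF.
  move=> e e0; have e2 : 0 < e ^+ 2 / 4 by rewrite divr_gt0 ?exprn_gt0.
  have [x Bx] := B0 _ e2; exists x, (e ^+ 2 / 4) => //= y By.
  rewrite /= -ltr_sqr ?nnegrE ?nrm_ge0 ?(ltW e0) //.
  by have := Bdist _ _ _ Bx By; lra.
exists v.
  apply: Ccl => e e0; have [e' e'0 sub] := Fv _ e0.
  by have [y By] := B0 _ e'0; exists y; [exact: By.1 | exact: sub].
move=> u Cu; rewrite -ler_sqr ?nnegrE ?nrm_ge0 //; apply: le_trans (dle _ Cu).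
rewrite leNgt; apply/negP => dv.
pose a := nrm v; pose t := (a ^+ 2 - d) / 2.
have a0 : 0 <= a := nrm_ge0 v.
have t0 : 0 < t by rewrite /t divr_gt0 // subr_gt0.
(* A vector within [e] of [v] has squared norm at least [(a - e)^2], which exceeds [a^2 - t] by this
   choice of [e]; yet vectors of [B t] have squared norm below [d + t = a^2 - t]. *)
pose e := t / (2 * a + 1).
have e0 : 0 < e by rewrite divr_gt0 //; lra.
have [y [[By ty] /= vy]] : exists y, B t y /\ nrm (v - y) < e.
  have FB : F (B t) by exists t.
  by have [y [? ?]] := @filter_ex _ F _ _ (filterI FB (Fv _ e0)); exists y.
have vle : a <= nrm y + nrm (v - y).
  by have := ler_nrmD (v - y) y; rewrite subrK [leRHS]addrC.
have te : t = e * (2 * a + 1) by rewrite /e divfK //; lra.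
have d0 : 0 <= d by apply: lb_le_inf Einf.1 _ => _ [w _ <-]; exact: sqr_ge0.
have ta : 2 * t <= a ^+ 2 by rewrite /t mulrC divfK //; lra.
have ae : 0 <= a - e.
  rewrite subr_ge0 leNgt; apply/negP => ae.
  have : a * a <= e * a by rewrite ler_wpM2r // ltW.
  by move: ta; rewrite te expr2; lra.
have : (a - e) ^+ 2 < a ^+ 2 - t.
  apply: (@le_lt_trans _ _ (nrm y ^+ 2)).
    by rewrite ler_sqr ?nnegrE ?nrm_ge0 //; lra.
  by rewrite (lt_le_trans ty) // /t; lra.
rewrite te !expr2 => h; have : 0 < e * e by rewrite mulr_gt0.
by move: h; lra.
Qed.

(** The vector [v] of least norm among the [x - c] with [c] in [C] is orthogonal to [C]: otherwise
    removing its component along [w] would shorten it. *)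
Lemma projection C : C 0 -> (forall x y, C x -> C y -> C (x + y)) ->
  (forall (r : R) x, C x -> C (r%:C *: x)) -> nclosed C ->
  forall x, exists2 p, C p & forall w, C w -> rip (x - p) w = 0.
Proof.
move=> C0 CD CZ Ccl x.
have CN u : C u -> C (- u).
  by move=> /(CZ (-1)); rewrite rmorphN rmorph1 scaleN1r.
pose D := [set y | C (x - y)].
have [||| v Dv vmin] := @min_nrm D.
- by exists x; rewrite /D /= subrr.
- move=> u v Du Dv; rewrite /D /=.
  rewrite (_ : x - _ = 2^-1%:C *: ((x - u) + (x - v))); first by apply/CZ/CD.
  rewrite addrACA -opprD [RHS]scalerDr scalerN; congr (_ - _).
  rewrite -[in RHS](scale1r x) -scalerDl scalerA -rmorphD -rmorphM /=.
  by rewrite (_ : 2^-1 * _ = 1) ?scale1r // mulVf.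
- move=> y hy; apply: Ccl => e e0; have [z Dz yz] := hy e e0.
  by exists (x - z) => //; rewrite opprB addrC addrA subrK nrmB.
exists (x - v) => // w Cw; rewrite subKr.
apply: contrapT => /eqP vw.
have ww : 0 < nrm w ^+ 2.
  rewrite lt_def sqr_ge0 andbT -ripxx; apply: contraNneq vw.
  rewrite ripxx => /eqP; rewrite sqrf_eq0 => /eqP/nrm0_eq0 ->.
  by rewrite -(subrr x) ripDr ripNr subrr.
pose r := rip v w / nrm w ^+ 2.
have := vmin (v - r%:C *: w).
rewrite /D /= opprB addrCA => /(_ (CD _ _ (CZ _ _ Cw) Dv)).
rewrite -ler_sqr ?nnegrE ?nrm_ge0 // sqr_nrmB nrmZ exprMn ripZr real_normK ?num_real //.
have -> : rip v w = r * nrm w ^+ 2 by rewrite /r divfK // gt_eqF.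
have r0 : 0 < r ^+ 2 by rewrite lt_def sqr_ge0 sqrf_eq0 mulf_neq0 // invr_eq0 gt_eqF.
by nra.
Qed.

End hilbert.

(** * Hilbert sums *)

Section unconditional_sum.
Variables (R : realType) (I : eqType).
Implicit Types (a b c p q : I -> R) (s t : seq I).

(** Index sets may be uncountable: sums over the power set of the group occur before the group is
    known to be countable. Hence the bound over finite duplicate-free lists. *)
Definition summ a := exists M : R, forall s, uniq s -> \sum_(i <- s) `|a i| <= M.

Definition ssup a : R := sup [set \sum_(i <- s) a i | s in [set s | uniq s]].

(* On a summable family, [ssum] is the difference of the sums of the positive
   and the negative parts. *)
Definition ssum a : R :=
  ssup (fun i => Num.max (a i) 0) - ssup (fun i => Num.max (- a i) 0).

Lemma summ_le a b : (forall i, `|a i| <= `|b i|) -> summ b -> summ a.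
Proof.
move=> ab [M bM]; exists M => s us; apply: le_trans (bM s us).
by apply: ler_sum => i _.
Qed.

Lemma summD a b : summ a -> summ b -> summ (fun i => a i + b i).
Proof.
move=> [M aM] [N bN]; exists (M + N) => s us.
apply: le_trans (lerD (aM s us) (bN s us)); rewrite -big_split /=.
by apply: ler_sum => i _; exact: ler_normD.
Qed.

Lemma summZ (r : R) a : summ a -> summ (fun i => r * a i).
Proof.
move=> [M aM]; exists (`|r| * M) => s us.
under eq_bigr do rewrite normrM.
by rewrite -mulr_sumr ler_wpM2l // aM.
Qed.

Lemma summN a : summ a -> summ (fun i => - a i).
Proof. by move=> sa; apply: summ_le sa => i; rewrite normrN. Qed.

Lemma summ_pos a : summ a -> summ (fun i => Num.max (a i) 0).
Proof.
by move=> sa; apply: summ_le sa => i; case: (leP (a i) 0) => _; rewrite ?normr0 ?lexx.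
Qed.

Lemma sum_subset a s t : (forall i, 0 <= a i) -> uniq s -> uniq t ->
  {subset s <= t} -> \sum_(i <- s) a i <= \sum_(i <- t) a i.
Proof.
move=> a0 us ut st; rewrite [leRHS](bigID (mem s)) /= -[X in _ <= X + _]big_filter.
rewrite [X in _ <= X + _](perm_big s) /=; first by rewrite lerDl sumr_ge0.
apply: uniq_perm => //; first exact: filter_uniq.
by move=> i; rewrite mem_filter /=; case: (boolP (i \in s)) => // /st ->.
Qed.

Lemma ssup_ge a s : (forall i, 0 <= a i) -> summ a -> uniq s ->
  \sum_(i <- s) a i <= ssup a.
Proof.
move=> a0 [M aM] us; apply: ub_le_sup; last by exists s.
exists M => _ [t ut <-]; apply: le_trans (aM t ut).
by apply: ler_sum => i _; exact: ler_norm.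
Qed.

Lemma ssup_le a M : (forall s, uniq s -> \sum_(i <- s) a i <= M) -> ssup a <= M.
Proof.
move=> aM; apply: ge_sup; first by exists 0, [::] => //; rewrite big_nil.
by move=> _ [s us <-]; exact: aM.
Qed.

Lemma ssup_ge0 a : (forall i, 0 <= a i) -> summ a -> 0 <= ssup a.
Proof. by move=> a0 /(ssup_ge a0)/(_ (isT : uniq [::])); rewrite big_nil. Qed.

Lemma ssupD a b : (forall i, 0 <= a i) -> (forall i, 0 <= b i) ->
  summ a -> summ b -> ssup (fun i => a i + b i) = ssup a + ssup b.
Proof.
move=> a0 b0 sa sb; apply/le_anti/andP; split.
  by apply: ssup_le => s us; rewrite big_split lerD ?ssup_ge.
rewrite -lerBrDr; apply: ssup_le => s us; rewrite lerBrDr -lerBrDl.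
apply: ssup_le => t ut; rewrite lerBrDl.
have ab0 i : 0 <= a i + b i by rewrite addr_ge0.
have uu : uniq (undup (s ++ t)) by exact: undup_uniq.
apply: le_trans (ssup_ge ab0 (summD sa sb) uu); rewrite big_split lerD //.
  by apply: sum_subset => // i; rewrite mem_undup mem_cat => ->.
by apply: sum_subset => // i; rewrite mem_undup mem_cat orbC => ->.
Qed.

Lemma ssupZ (r : R) a : 0 <= r -> (forall i, 0 <= a i) -> summ a ->
  ssup (fun i => r * a i) = r * ssup a.
Proof.
(* This inequality, used for [r] and for [r^-1], gives both directions. *)
have le u b : 0 <= u -> (forall i, 0 <= b i) -> summ b ->
    ssup (fun i => u * b i) <= u * ssup b.
  move=> u0 b0 sb; apply: ssup_le => s us; rewrite -mulr_sumr.
  by rewrite ler_wpM2l // ssup_ge.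
move=> r0 a0 sa; apply/le_anti; rewrite le //=.
have [->|rn0] := eqVneq r 0.
  by rewrite mul0r ssup_ge0 // => [i|]; [rewrite mul0r | exact: summZ].
rewrite -ler_pdivlMl ?lt_def ?rn0 //.
apply: le_trans (le r^-1 (fun i => r * a i) _ _ _).
- by under [X in _ <= ssup X]funext do rewrite mulKf //.
- by rewrite invr_ge0.
- by move=> i; rewrite mulr_ge0.
- exact: summZ.
Qed.

(** The value is independent of the splitting into nonnegative families: [p] plus the negative part
    of [a] equals [q] plus its positive part, and [ssup] is additive on such families. *)
Lemma ssumE a p q : (forall i, 0 <= p i) -> (forall i, 0 <= q i) ->
  summ p -> summ q -> (forall i, a i = p i - q i) -> ssum a = ssup p - ssup q.
Proof.
move=> p0 q0 sp sq apq; have sa : summ a.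
  by rewrite (_ : a = fun i => p i + - q i); [exact/summD/summN | exact/funext].
have m0 (x : R) : 0 <= Num.max x 0 by rewrite le_max lexx orbT.
apply/eqP; rewrite /ssum subr_eq addrAC eq_sym subr_eq; apply/eqP.
rewrite -ssupD //; [| exact: summ_pos (summN sa)].
rewrite -ssupD //; [| exact: summ_pos sa].
congr ssup; apply/funext => i; rewrite apq.
by case: (leP (p i - q i) 0) => h; case: (leP (- (p i - q i)) 0) => h'; lra.
Qed.

Lemma ssum_ge0E a : (forall i, 0 <= a i) -> summ a -> ssum a = ssup a.
Proof.
move=> a0 sa; have s0 : summ (fun=> 0).
  by exists 0 => s _; rewrite big1 // => i; rewrite normr0.
rewrite (@ssumE a a (fun=> 0)) // => [|i]; last by rewrite subr0.
rewrite [X in _ - X](_ : _ = 0) ?subr0 //; apply/le_anti/andP; split.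
  by apply: ssup_le => s _; rewrite big1.
exact: ssup_ge0.
Qed.

Lemma ssumD a b : summ a -> summ b -> ssum (fun i => a i + b i) = ssum a + ssum b.
Proof.
move=> sa sb; have m0 (x : R) : 0 <= Num.max x 0 by rewrite le_max lexx orbT.
have sa' := summN sa; have sb' := summN sb.
rewrite (ssumE (p := fun i => Num.max (a i) 0 + Num.max (b i) 0)
  (q := fun i => Num.max (- a i) 0 + Num.max (- b i) 0)).
- rewrite !ssupD //; try exact: summ_pos.
  by rewrite /ssum; ring.
- by move=> i; rewrite addr_ge0.
- by move=> i; rewrite addr_ge0.
- by apply: summD; exact: summ_pos.
- by apply: summD; exact: summ_pos.
move=> i; case: (leP (a i) 0); case: (leP (- a i) 0); case: (leP (b i) 0);
  case: (leP (- b i) 0) => *; lra.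
Qed.

Lemma ssumN a : ssum (fun i => - a i) = - ssum a.
Proof.
rewrite /ssum opprB; congr (_ - _); congr ssup; apply/funext => i.
by rewrite opprK.
Qed.

Lemma ssumZ (r : R) a : summ a -> ssum (fun i => r * a i) = r * ssum a.
Proof.
move=> sa; have m0 (x : R) : 0 <= Num.max x 0 by rewrite le_max lexx orbT.
wlog r0 : r / 0 <= r.
  move=> H; have [/H//|r0] := lerP 0 r.
  have := H (- r); rewrite oppr_ge0 ltW // => /(_ isT) e.
  rewrite -[RHS]opprK -mulNr -e -ssumN; congr ssum; apply/funext => i.
  by rewrite mulNr opprK.
rewrite [in RHS]/ssum mulrBr -!ssupZ //; try exact/summ_pos/summN; try exact: summ_pos.
apply: ssumE => [i|i|||i]; rewrite ?mulr_ge0 //.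
- exact/summZ/summ_pos.
- exact/summZ/summ_pos/summN.
by rewrite -mulrBr; congr (_ * _); case: (leP (a i) 0); case: (leP (- a i) 0) => *; lra.
Qed.

Lemma ssum_ge a s : (forall i, 0 <= a i) -> summ a -> uniq s ->
  \sum_(i <- s) a i <= ssum a.
Proof. by move=> a0 sa us; rewrite ssum_ge0E // ssup_ge. Qed.

Lemma ssum_le a M : (forall i, 0 <= a i) -> summ a ->
  (forall s, uniq s -> \sum_(i <- s) a i <= M) -> ssum a <= M.
Proof. by move=> a0 sa aM; rewrite ssum_ge0E //; exact: ssup_le. Qed.

Lemma ssum_ge0 a : (forall i, 0 <= a i) -> summ a -> 0 <= ssum a.
Proof. by move=> a0 sa; rewrite ssum_ge0E // ssup_ge0. Qed.

Lemma ssup_reindex (f g : I -> I) a : cancel f g -> cancel g f ->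
  ssup (a \o f) = ssup a.
Proof.
move=> fK gK; congr sup; apply/seteqP; split=> _ [s /= us <-].
  by exists (map f s); rewrite /= ?(map_inj_uniq (can_inj fK)) // big_map.
exists (map g s); rewrite /= ?(map_inj_uniq (can_inj gK)) // big_map.
by apply: eq_bigr => i _; rewrite /= gK.
Qed.

Lemma ssum_reindex (f g : I -> I) a : cancel f g -> cancel g f ->
  ssum (a \o f) = ssum a.
Proof.
move=> fK gK; rewrite /ssum.
rewrite -(ssup_reindex (fun i => Num.max (a i) 0) fK gK).
by rewrite -(ssup_reindex (fun i => Num.max (- a i) 0) fK gK).
Qed.

End unconditional_sum.

(** * Complex scalars and closed complex subspaces *)

Section complex_hilbert.
Variables (R : realType) (H : hilbertType R).
Implicit Types x y : H.

Local Notation "'j'" := (0 +i* 1 : R[i]).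

Lemma complex_ij (c : R[i]) : c = (complex.Re c)%:C + (complex.Im c)%:C * j.
Proof.
by case: c => a b; apply/eqP; rewrite eq_complex /=; apply/andP; split; apply/eqP; ring.
Qed.

Lemma scale_ij (V : lmodType R[i]) (c : R[i]) (x : V) :
  c *: x = (complex.Re c)%:C *: x + (complex.Im c)%:C *: (j *: x).
Proof. by rewrite scalerA -scalerDl -complex_ij. Qed.

Lemma jj : j * j = -1.
Proof. by apply/eqP; rewrite eq_complex /=; apply/andP; split; apply/eqP; ring. Qed.

Lemma rip_jl x y : rip (j *: x) (j *: y) = rip x y.
Proof.
rewrite /rip linearZl_LR linearZr_LR /= mulrA.
by rewrite (_ : j * _ = 1) ?mul1r //; apply/eqP; rewrite eq_complex /=;
  apply/andP; split; apply/eqP; ring.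
Qed.

Lemma rip_sqr_ge0 x : 0 <= rip x x.
Proof. by rewrite ripxx sqr_ge0. Qed.

Lemma rip_bound x y : `|rip x y| <= nrm x ^+ 2 + nrm y ^+ 2.
Proof.
have := sqr_nrmD x y; have := sqr_nrmB x y.
have := sqr_ge0 (nrm (x + y)); have := sqr_ge0 (nrm (x - y)).
have := sqr_ge0 (nrm x); have := sqr_ge0 (nrm y).
by rewrite ler_norml => *; apply/andP; split; lra.
Qed.

Record csub := CSub {
  csub_set :> H -> Prop;
  csub0 : csub_set 0;
  csubD : forall x y, csub_set x -> csub_set y -> csub_set (x + y);
  csubZ : forall (c : R[i]) x, csub_set x -> csub_set (c *: x);
  csub_closed : nclosed csub_set }.

Lemma csubN (V : csub) x : V x -> V (- x).
Proof. by rewrite -scaleN1r; exact: csubZ. Qed.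

Definition csubT : csub.
Proof. by exists (fun=> True). Defined.

End complex_hilbert.

(** The coordinates are confined to closed subspaces [V i], so that a subrepresentation enters a
    Hilbert sum without first being made into a Hilbert space of its own. *)
Record l2sum (R : realType) (I : choiceType) (H : I -> hilbertType R)
    (V : forall i, csub (H i)) := L2sum {
  l2val :> forall i, H i;
  l2sub : forall i, V i (l2val i);
  l2summ : summ (fun i => nrm (l2val i) ^+ 2) }.

Section l2sum.
Variables (R : realType) (I : choiceType) (H : I -> hilbertType R).
Variable V : forall i, csub (H i).
Implicit Types f g h : l2sum V.
Local Notation "'j'" := (0 +i* 1 : R[i]).

Lemma l2val_inj : injective (@l2val R I H V).
Proof.
move=> [f fV fs] [g gV gs] /= fg; case: _ / fg in gV gs *.
by congr L2sum; exact: Prop_irrelevance.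
Qed.

Lemma l2P f g : (forall i, f i = g i) -> f = g.
Proof. by move=> fg; apply/l2val_inj/functional_extensionality_dep. Qed.

HB.instance Definition _ := gen_eqMixin (l2sum V).
HB.instance Definition _ := gen_choiceMixin (l2sum V).

Fact l2zero_summ : summ (fun i => nrm (0 : H i) ^+ 2).
Proof. by exists 0 => s _; rewrite big1 // => i _; rewrite nrm0 expr0n normr0. Qed.

Definition l2zero : l2sum V := L2sum (fun i => csub0 (V i)) l2zero_summ.

Lemma sqr_nrmD_le (K : hilbertType R) (x y : K) :
  nrm (x + y) ^+ 2 <= 2 * nrm x ^+ 2 + 2 * nrm y ^+ 2.
Proof.
have := sqr_nrmD x y; have := sqr_nrmB x y; have := sqr_ge0 (nrm (x - y)); lra.
Qed.

Lemma summ_sqrD (f g : forall i, H i) : summ (fun i => nrm (f i) ^+ 2) ->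
  summ (fun i => nrm (g i) ^+ 2) -> summ (fun i => nrm (f i + g i) ^+ 2).
Proof.
move=> fs gs; apply: summ_le (summD (summZ 2 fs) (summZ 2 gs)) => i.
rewrite ger0_norm ?sqr_ge0 //.
by apply: le_trans (ler_norm _); exact: sqr_nrmD_le.
Qed.

Definition l2add f g : l2sum V :=
  L2sum (fun i => csubD (l2sub f i) (l2sub g i)) (summ_sqrD (l2summ f) (l2summ g)).

Lemma sqr_nrmZ (K : hilbertType R) (c : R[i]) (x : K) :
  nrm (c *: x) ^+ 2 = (complex.Re `|c|) ^+ 2 * nrm x ^+ 2.
Proof. by rewrite /nrm normrZ normc_def ReZ exprMn. Qed.

Fact l2scale_summ (c : R[i]) f : summ (fun i => nrm (c *: f i) ^+ 2).
Proof.
under [X in summ X]funext do rewrite sqr_nrmZ.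
exact/summZ/l2summ.
Qed.

Definition l2scale (c : R[i]) f : l2sum V :=
  L2sum (fun i => csubZ c (l2sub f i)) (l2scale_summ c f).

Fact l2addA : associative l2add.
Proof. by move=> f g h; apply: l2P => i /=; rewrite addrA. Qed.
Fact l2addC : commutative l2add.
Proof. by move=> f g; apply: l2P => i /=; rewrite addrC. Qed.
Fact l2add0 : left_id l2zero l2add.
Proof. by move=> f; apply: l2P => i /=; rewrite add0r. Qed.
Fact l2addN : left_inverse l2zero (l2scale (-1)) l2add.
Proof. by move=> f; apply: l2P => i /=; rewrite scaleN1r addNr. Qed.

HB.instance Definition _ := GRing.isZmodule.Build (l2sum V)
  l2addA l2addC l2add0 l2addN.

Fact l2scaleA (c d : R[i]) f : l2scale c (l2scale d f) = l2scale (c * d) f.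
Proof. by apply: l2P => i /=; rewrite scalerA. Qed.
Fact l2scale1 : left_id 1 l2scale.
Proof. by move=> f; apply: l2P => i /=; rewrite scale1r. Qed.
Fact l2scaleDr : right_distributive l2scale +%R.
Proof. by move=> c f g; apply: l2P => i /=; rewrite scalerDr. Qed.
Fact l2scaleDl f : {morph l2scale^~ f : c d / c + d}.
Proof. by move=> c d; apply: l2P => i /=; rewrite scalerDl. Qed.

HB.instance Definition _ := GRing.Zmodule_isLmodule.Build R[i] (l2sum V)
  l2scaleA l2scale1 l2scaleDr l2scaleDl.

Lemma l2DE f g i : (f + g) i = f i + g i. Proof. by []. Qed.
Lemma l2NE f i : (- f) i = - f i. Proof. by rewrite -[RHS]scaleN1r. Qed.
Lemma l2BE f g i : (f - g) i = f i - g i. Proof. by rewrite l2DE l2NE. Qed.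

Definition l2rip f g : R := ssum (fun i => rip (f i) (g i)).

Lemma l2rip_summ f g : summ (fun i => rip (f i) (g i)).
Proof.
apply: summ_le (summD (l2summ f) (l2summ g)) => i.
by apply: le_trans (ler_norm _); exact: rip_bound.
Qed.

Lemma l2ripC f g : l2rip f g = l2rip g f.
Proof. by congr ssum; apply/funext => i; rewrite ripC. Qed.

Lemma l2ripDl f g h : l2rip (f + g) h = l2rip f h + l2rip g h.
Proof.
rewrite /l2rip -ssumD; try exact: l2rip_summ.
by congr ssum; apply/funext => i; rewrite ripDl.
Qed.

Lemma l2ripZl (r : R) f g : l2rip (r%:C *: f) g = r * l2rip f g.
Proof.
rewrite /l2rip -ssumZ; last exact: l2rip_summ.
by congr ssum; apply/funext => i; rewrite ripZl.
Qed.

Lemma l2rip_j f g : l2rip (j *: f) (j *: g) = l2rip f g.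
Proof. by congr ssum; apply/funext => i; rewrite rip_jl. Qed.

Lemma l2ripNl f g : l2rip (- f) g = - l2rip f g.
Proof.
rewrite (_ : - f = (-1)%:C *: f) ?l2ripZl ?mulN1r //.
by rewrite rmorphN rmorph1 scaleN1r.
Qed.

Lemma l2rip_jN f g : l2rip (j *: f) g = - l2rip f (j *: g).
Proof. by rewrite -l2rip_j scalerA jj scaleN1r l2ripNl. Qed.

Lemma l2rip_ge0 f : 0 <= l2rip f f.
Proof. by apply: ssum_ge0 (l2rip_summ f f) => i; exact: rip_sqr_ge0. Qed.

Lemma l2rip_eq0 f : l2rip f f = 0 -> f = 0.
Proof.
move=> f0; apply: l2P => i; apply/nrm0_eq0/eqP; rewrite -sqrf_eq0 eq_le sqr_ge0 andbT.
rewrite -ripxx -f0; have := @ssum_ge _ _ _ [:: i] _ (l2rip_summ f f).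
by rewrite big_seq1; apply=> // k; exact: rip_sqr_ge0.
Qed.

Lemma l2rip_CS f g : l2rip f g ^+ 2 <= l2rip f f * l2rip g g.
Proof.
have [/l2rip_eq0 ->|f0] := eqVneq (l2rip f f) 0.
  rewrite (_ : l2rip 0 g = 0) ?expr0n ?mulr_ge0 ?l2rip_ge0 //.
  by rewrite -(scale0r 0) l2ripZl mul0r.
have fgt0 : 0 < l2rip f f by rewrite lt_def f0 l2rip_ge0.
(* This [t] minimises the squared norm of [t f + g]. *)
pose t := - (l2rip f g / l2rip f f).
set h := t%:C *: f; have := l2rip_ge0 (h + g).
have -> : l2rip (h + g) (h + g) = l2rip h h + 2 * l2rip h g + l2rip g g.
  by rewrite l2ripDl !(l2ripC _ (h + g)) !l2ripDl (l2ripC g h); ring.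
have -> : l2rip h h = t * (t * l2rip f f) by rewrite l2ripZl l2ripC l2ripZl.
have te : l2rip f g = - t * l2rip f f by rewrite opprK divfK.
rewrite l2ripZl te; move: (l2rip f f) (l2rip g g) fgt0 => F G F0 h0.
have : 0 <= F * (t * (t * F) + 2 * (t * (- t * F)) + G) by rewrite mulr_ge0 // ltW.
move=> pos; rewrite -subr_ge0.
by rewrite (_ : _ - _ = F * (t * (t * F) + 2 * (t * (- t * F)) + G)) //; ring.
Qed.

Definition l2norm f : R[i] := (Num.sqrt (l2rip f f))%:C.

Lemma sqr_l2norm f : Num.sqrt (l2rip f f) ^+ 2 = l2rip f f.
Proof. by rewrite sqr_sqrtr // l2rip_ge0. Qed.

Fact ler_l2normD f g : l2norm (f + g) <= l2norm f + l2norm g.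
Proof.
rewrite /l2norm -rmorphD lecR -ler_sqr ?nnegrE ?addr_ge0 ?sqrtr_ge0 //.
rewrite sqrrD !sqr_l2norm l2ripDl !(l2ripC _ (f + g)) !l2ripDl (l2ripC g f).
rewrite [leLHS](_ : _ = l2rip f f + l2rip f g *+ 2 + l2rip g g); last by ring.
rewrite lerD2r lerD2l lerMn2r /= -sqrtrM ?l2rip_ge0 //.
apply: le_trans (ler_norm _) _; rewrite -sqrtr_sqr ler_sqrt ?l2rip_CS //.
by rewrite mulr_ge0 // l2rip_ge0.
Qed.

Fact l2normZ (c : R[i]) f : l2norm (c *: f) = `|c| * l2norm f.
Proof.
rewrite -[`|c|]RRe_real ?normr_real // /l2norm -rmorphM /=; congr (_%:C).
have c0 : 0 <= complex.Re `|c| by rewrite normc_def sqrtr_ge0.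
rewrite (_ : l2rip _ _ = complex.Re `|c| ^+ 2 * l2rip f f).
  by rewrite sqrtrM ?sqr_ge0 // sqrtr_sqr ger0_norm.
rewrite /l2rip -ssumZ; last exact: l2rip_summ.
by congr ssum; apply/funext => i; rewrite !ripxx -sqr_nrmZ.
Qed.

Fact l2norm_eq0 f : l2norm f = 0 -> f = 0.
Proof.
move=> /(congr1 (@complex.Re _)) /= f0; apply: l2rip_eq0.
by rewrite -sqr_l2norm f0 expr0n.
Qed.

HB.instance Definition _ := Lmodule_isNormed.Build R[i] (l2sum V)
  ler_l2normD l2normZ l2norm_eq0.

Lemma l2_normE f : `|f| = (Num.sqrt (l2rip f f))%:C. Proof. by []. Qed.

Definition l2nrm f : R := Num.sqrt (l2rip f f).

Lemma l2nrm_coord f i : nrm (f i) <= l2nrm f.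
Proof.
rewrite -ler_sqr ?nnegrE ?nrm_ge0 ?sqrtr_ge0 // sqr_l2norm -ripxx.
have := @ssum_ge _ _ _ [:: i] _ (l2rip_summ f f).
by rewrite big_seq1; apply=> // k; exact: rip_sqr_ge0.
Qed.

Lemma l2nrm_le f (e : R) : 0 <= e ->
  (forall s, uniq s -> \sum_(i <- s) nrm (f i) ^+ 2 <= e ^+ 2) -> l2nrm f <= e.
Proof.
move=> e0 fe; rewrite -ler_sqr ?nnegrE ?sqrtr_ge0 // sqr_l2norm.
apply: ssum_le (l2rip_summ f f) _ => [i|s us]; first exact: rip_sqr_ge0.
by apply: le_trans (fe s us); apply: ler_sum => i _; rewrite ripxx.
Qed.

Lemma l2nrm_ge f s : uniq s -> \sum_(i <- s) nrm (f i) ^+ 2 <= l2nrm f ^+ 2.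
Proof.
move=> us; rewrite sqr_l2norm; under eq_bigr do rewrite -ripxx.
by apply: ssum_ge (l2rip_summ f f) us => i; exact: rip_sqr_ge0.
Qed.

Fact l2_complete (F : set_system (l2sum V)) : ProperFilter F -> cauchy F -> cvg F.
Proof.
move=> FF /cauchyP Fc.
have {}Fc (e : R) : 0 < e -> exists f, F [set g | l2nrm (f - g) < e].
  move=> e0; have [|f Ff] := Fc e%:C; first by rewrite ltcR.
  by exists f; apply: filterS Ff => g; rewrite -ball_normE /ball_ /= l2_normE ltcR.
have lim i : exists x, forall e : R, 0 < e -> F [set f | nrm (x - f i) < e].
  have [|x Fx] := @nrm_complete _ _ ((fun f : l2sum V => f i) @ F) _.
    move=> e /Fc[f Ff]; exists (f i); apply: (@filterS _ F _ _ _ _ Ff) => g.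
    rewrite /= -l2BE; apply: le_lt_trans; exact: l2nrm_coord.
  by exists x.
pose x i := projT1 (cid (lim i)).
have xP i : forall e : R, 0 < e -> F [set f | nrm (x i - f i) < e].
  exact: projT2 (cid (lim i)).
have xV i : V i (x i).
  apply: csub_closed => e e0; have [f xf] := filter_ex (xP i e e0).
  by exists (f i) => //; exact: l2sub.
(* A single [g] in the filter is within [e] of [f] in norm and within [d] of [x] at each index of
   [s]. As [d] is scaled by the length of [s], the resulting bound is the same for all [s]. *)
have close (e : R) f s : 0 < e -> F [set g | l2nrm (f - g) < e] -> uniq s ->
    \sum_(i <- s) nrm (x i - f i) ^+ 2 <= (2 * e) ^+ 2.
  move=> e0 Ff us; pose d := e / (size s).+1%:R.
  have d0 : 0 < d by rewrite divr_gt0.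
  have Fs : F [set g : l2sum V | forall i, i \in s -> nrm (x i - g i) < d].
    elim: s {us} d d0 => [|k s IH] d d0; first exact: filterE.
    apply: filterS (filterI (xP k d d0) (IH d d0)) => g [gk gs] i.
    by rewrite inE => /predU1P[->|/gs].
  have [g [gs fg]] := filter_ex (filterI Fs Ff).
  apply: (@le_trans _ _ (\sum_(i <- s) (2 * d ^+ 2 + 2 * nrm ((g - f) i) ^+ 2))).
    rewrite big_seq [leRHS]big_seq; apply: ler_sum => i /gs xg.
    rewrite -(subrKA (g i) (x i) (- f i)); apply: le_trans (sqr_nrmD_le _ _) _.
    rewrite l2BE lerD2r ler_pM2l // ler_sqr ?nnegrE ?nrm_ge0 ?ltW //.
  rewrite big_split /= -[X in _ + X <= _]mulr_sumr.
  have h1 : \sum_(i <- s) nrm ((g - f) i) ^+ 2 <= e ^+ 2.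
    apply: le_trans (l2nrm_ge _ us) _.
    rewrite ler_sqr ?nnegrE ?sqrtr_ge0 ?(ltW e0) // ltW //.
    rewrite (_ : l2nrm _ = l2nrm (f - g)) //.
    by rewrite /l2nrm -opprB l2ripNl l2ripC l2ripNl opprK.
  have h2 : \sum_(i <- s) 2 * d ^+ 2 <= 2 * e ^+ 2.
    rewrite big_const_seq count_predT iter_addr_0 -mulr_natl.
    have n0 : 0 < (size s).+1%:R :> R by [].
    have ed : e = (size s)%:R * d + d.
      by rewrite -[X in _ + X]mul1r -mulrDl natr1 /d mulrC divfK // gt_eqF.
    have n1 : 0 <= (size s)%:R :> R by [].
    have dd : 0 <= d * d by rewrite -expr2 sqr_ge0.
    have := mulr_ge0 n1 (mulr_ge0 n1 dd); have := mulr_ge0 n1 dd.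
    by rewrite !expr2 ed; lra.
  by lra.
have xs : summ (fun i => nrm (x i) ^+ 2).
  have [f Ff] := Fc 1 ltr01; under [X in summ X]funext do rewrite -[x _](subrK (f _)).
  apply: summ_sqrD (l2summ f); exists ((2 * 1) ^+ 2) => s us.
  by under eq_bigr do rewrite ger0_norm ?sqr_ge0 //; exact: close.
pose xx : l2sum V := L2sum xV xs.
apply/cvg_ex; exists xx => U /nbhs_ballP[e /= e0 eU].
have eE : e = (complex.Re e)%:C by rewrite RRe_real // gtr0_real.
have e3 : 0 < complex.Re e / 3 by rewrite divr_gt0 // -ltcR -eE.
have [f Ff] := Fc _ e3; apply: filterS (Ff) => g fg; apply: eU.
rewrite -ball_normE /ball_ /= l2_normE eE ltcR -/(l2nrm (xx - g)).
have tri u v : l2nrm (u + v) <= l2nrm u + l2nrm v.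
  by have := ler_l2normD u v; rewrite /l2norm -rmorphD lecR.
rewrite -(subrKA f xx (- g)); apply: le_lt_trans (tri _ _) _.
have : l2nrm (xx - f) <= 2 * (complex.Re e / 3).
  apply: l2nrm_le => [|s us]; first by rewrite mulr_ge0 // ltW.
  under eq_bigr do rewrite l2BE.
  exact: (close _ _ _ e3 Ff us).
move: fg; rewrite /=; lra.
Qed.

End l2sum.

(** * The scalars as a one-dimensional Hilbert space *)

Section scalar_hilbert.
Variable R : realType.

Fact complex_complete (F : set_system (R[i]^o)) : ProperFilter F -> cauchy F -> cvg F.
Proof.
move=> FF /cauchyP Fc.
have {}Fc (e : R) : 0 < e -> exists z : R[i]^o, F [set w | `|z - w| < e%:C].
  move=> e0; have [|f Ff] := Fc e%:C; first by rewrite ltcR.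
  by exists f; apply: filterS Ff => g; rewrite -ball_normE /ball_ /=.
have lim (p : R[i] -> R) : (forall z, `|p z|%:C <= `|z|) ->
    (forall z w, p (z - w) = p z - p w) ->
    exists x, forall e : R, 0 < e -> F [set w | `|x - p w| < e].
  move=> ple pB; have /cauchy_cvg/cvg_ex[x Fx] : cauchy (p @ F).
    apply: cauchy_exP => e /Fc[z Fz]; exists (p z); apply: (@filterS _ F _ _ _ _ Fz) => w.
    rewrite /= -ball_normE /ball_ /= -pB -ltcR; apply: le_lt_trans; exact: ple.
  exists x => e e0; have := Fx _ (nbhsx_ballx x e e0).
  by apply: (@filterS _ F) => w; rewrite /= -ball_normE.
have [||a Fa] := lim (@complex.Re R).
- exact: normc_ge_Re.
- by move=> [? ?] [? ?].
have [||b Fb] := lim (@complex.Im R).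
- by move=> z; rewrite normc_def lecR -sqrtr_sqr ler_wsqrtr // lerDr sqr_ge0.
- by move=> [? ?] [? ?].
apply/cvg_ex; exists (a +i* b) => U /nbhs_ballP[e /= e0 eU].
have eE : e = (complex.Re e)%:C by rewrite RRe_real // gtr0_real.
have e2 : 0 < complex.Re e / 2 by rewrite divr_gt0 // -ltcR -eE.
apply: filterS (filterI (Fa _ e2) (Fb _ e2)) => -[u v] /= [au bv]; apply: eU.
rewrite -ball_normE /ball_ /= eE normc_def ltcR /=.
apply: (@le_lt_trans _ _ (`|a - u| + `|b - v|)); last by lra.
rewrite -ler_sqr ?nnegrE ?sqrtr_ge0 ?addr_ge0 // sqr_sqrtr ?addr_ge0 ?sqr_ge0 //.
rewrite [leRHS]sqrrD !real_normK ?num_real // addrAC lerDl.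
by rewrite mulrn_wge0 // mulr_ge0.
Qed.

(* An alias, since the library already attaches its completeness instances of
   [R^o] to the head symbol of [R[i]^o]. *)
Definition scalars : Type := R[i]^o.
HB.instance Definition _ := NormedModule.copy scalars (R[i]^o).
HB.instance Definition _ := Uniform_isComplete.Build scalars complex_complete.

Definition cdot (x y : scalars) : R[i] := (x : R[i]) * Num.conj (y : R[i]).

Fact cdot_bilinear : bilinear_for (GRing.Scale.Law.clone _ _ *%R _)
  (GRing.Scale.Law.clone _ _ (Num.conj \; *%R) _) cdot.
Proof.
split=> u c x y; rewrite /cdot /=.
  by rewrite mulrDl mulrA.
by rewrite rmorphD rmorphM mulrDr mulrCA.
Qed.

HB.instance Definition _ := @bilinear_isBilinear.Build _ _ _ _ _ _ _ cdot_bilinear.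

Fact cdot_hermitian (x y : scalars) : cdot x y = (-1) ^+ false * Num.conj (cdot y x).
Proof. by rewrite expr0 mul1r /cdot rmorphM /= conjCK mulrC. Qed.

HB.instance Definition _ := @isHermitianSesquilinear.Build _ _ _ _ _ cdot_hermitian.

Fact cdot_gt0 (x : scalars) : x != 0 -> 0 < cdot x x.
Proof. by move=> x0; rewrite /cdot -normCK exprn_gt0 // normr_gt0. Qed.

HB.instance Definition _ := @isDotProduct.Build _ _ _ cdot_gt0.

Fact sqr_norm_cdot (x : scalars) : `|x| ^+ 2 = cdot x x.
Proof. exact: normCK. Qed.

Definition chilbert : hilbertType R :=
  @HilbertType R (scalars : completeNormedModType R[i])
    (cdot : {dot scalars for @Num.conj R[i]}) sqr_norm_cdot.

End scalar_hilbert.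

Section l2hilbert.
Variables (R : realType) (I : choiceType) (H : I -> hilbertType R).
Variable V : forall i, csub (H i).
Implicit Types f g h : l2sum V.
Local Notation "'j'" := (0 +i* 1 : R[i]).

HB.instance Definition _ := Uniform_isComplete.Build (l2sum V) (@l2_complete _ _ _ V).

(** The complex inner product recovered from its real part: the imaginary part of [<f, g>] is minus
    the real part of [<j f, g>]. *)
Definition l2dot f g : R[i] := l2rip f g +i* (- l2rip (j *: f) g).

Fact l2dot_hermitian f g : l2dot f g = (-1) ^+ false * Num.conj (l2dot g f).
Proof.
rewrite expr0 mul1r /l2dot; apply/eqP; rewrite eq_complex /= l2ripC eqxx /=.
by rewrite l2rip_jN l2ripC.
Qed.

Fact l2dot_linear g : linear_for *%R (l2dot^~ g).
Proof.
move=> c f h; rewrite /l2dot scalerDr scalerA !l2ripDl.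
have Z (d : R[i]) : l2rip (d *: f) g =
    complex.Re d * l2rip f g + complex.Im d * l2rip (j *: f) g.
  by rewrite scale_ij l2ripDl !l2ripZl.
rewrite (Z c) (Z (j * c)); apply/eqP; rewrite eq_complex; case: c {Z} => a b /=.
by apply/andP; split; apply/eqP; ring.
Qed.

Fact l2dot_bilinear : bilinear_for (GRing.Scale.Law.clone _ _ *%R _)
  (GRing.Scale.Law.clone _ _ (Num.conj \; *%R) _) l2dot.
Proof.
split=> u c x y /=; first by rewrite l2dot_linear.
rewrite l2dot_hermitian expr0 mul1r l2dot_linear rmorphD rmorphM /=.
by rewrite !(l2dot_hermitian u) !expr0 !mul1r.
Qed.

HB.instance Definition _ := @bilinear_isBilinear.Build _ _ _ _ _ _ _ l2dot_bilinear.
HB.instance Definition _ := @isHermitianSesquilinear.Build _ _ _ _ _ l2dot_hermitian.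

Lemma l2dotxx f : l2dot f f = (l2rip f f)%:C.
Proof.
apply/eqP; rewrite eq_complex /= eqxx /= oppr_eq0.
have := l2rip_jN f f; rewrite [in X in _ = - X]l2ripC; lra.
Qed.

Fact l2dot_gt0 f : f != 0 -> 0 < l2dot f f.
Proof.
move=> f0; rewrite l2dotxx ltcR lt_def l2rip_ge0 andbT.
by apply: contraNneq f0 => /l2rip_eq0 ->.
Qed.

HB.instance Definition _ := @isDotProduct.Build _ _ _ l2dot_gt0.

Fact sqr_norm_l2dot f : `|f| ^+ 2 = l2dot f f.
Proof. by rewrite l2_normE -rmorphXn /= sqr_l2norm l2dotxx. Qed.

Definition l2hilbert : hilbertType R :=
  @HilbertType R (l2sum V : completeNormedModType R[i])
    (l2dot : {dot l2sum V for @Num.conj R[i]}) sqr_norm_l2dot.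

Fact l2delta_subproof i (x : H i) : V i x -> forall k, V k (dfwith (fun k => 0) i x k).
Proof.
move=> Vx k; have [->|ki] := eqVneq k i; first by rewrite dfwithin.
by rewrite dfwithout 1?eq_sym //; exact: csub0.
Qed.

Fact l2delta_summ i (x : H i) : summ (fun k => nrm (dfwith (fun k => 0) i x k) ^+ 2).
Proof.
exists (nrm x ^+ 2) => s us; under eq_bigr do rewrite ger0_norm ?sqr_ge0 //.
have [is_|is_] := boolP (i \in s).
  rewrite (bigD1_seq i) //= dfwithin big1 ?addr0 // => k ki.
  by rewrite dfwithout 1?eq_sym // nrm0 expr0n.
rewrite big_seq big1 ?sqr_ge0 // => k ks; rewrite dfwithout ?nrm0 ?expr0n //.
by apply: contraNneq is_ => ->.
Qed.

Definition l2delta i (x : H i) (Vx : V i x) : l2hilbert :=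
  L2sum (l2delta_subproof Vx) (l2delta_summ x).

Lemma l2deltaE i (x : H i) (Vx : V i x) : (l2delta Vx) i = x.
Proof. by rewrite /= dfwithin. Qed.

Lemma l2deltaE0 i k (x : H i) (Vx : V i x) : k != i -> (l2delta Vx) k = 0.
Proof. by move=> ki; rewrite /= dfwithout // eq_sym. Qed.

Lemma nrm_supported_at i (f : l2hilbert) : (forall k, k != i -> f k = 0) ->
  nrm f = nrm (f i).
Proof.
move=> f0; apply/le_anti/andP; split; last exact: l2nrm_coord.
apply: l2nrm_le => [|s us]; first exact: nrm_ge0.
have [is_|is_] := boolP (i \in s).
  rewrite (bigD1_seq i) //= big1 ?addr0 // => k ki.
  by rewrite f0 // nrm0 expr0n.
rewrite big_seq big1 ?sqr_ge0 // => k ks; rewrite f0 ?nrm0 ?expr0n //.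
by apply: contraNneq is_ => <-.
Qed.

End l2hilbert.

(** * Unitary representations and spectral gaps *)

Lemma locally_constant_continuous (T U : topologicalType) (f : T -> U) :
  (forall x, \forall y \near x, f y = f x) -> continuous f.
Proof.
move=> fc x A /nbhs_singleton Afx; apply: filterS (fc x) => y yx.
by rewrite /= yx.
Qed.

Lemma discrete_continuous (G : discreteGroupType) (U : topologicalType) (f : G -> U) :
  continuous f.
Proof.
apply: locally_constant_continuous => x.
by apply: filterS (discrete_set1 x) => y ->.
Qed.

(** On an infinite [K], the sets missing only finitely many points of [K] form a proper filter,
    which no point can cluster. *)
Lemma compact_discrete_finite (T : discreteTopologicalType) (K : set T) :
  compact K -> finite_set K.
Proof.
move=> Kc; apply: contrapT => Kinf.
pose F : set_system T := [set A | finite_set (K `\` A)].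
have FF : ProperFilter F.
  split; first by rewrite /F /= setD0.
  split=> [|A B FA FB|A B AB]; first by rewrite /F /= setDT; exact: finite_set0.
    by rewrite /F /= setDIr finite_setU.
  by apply: sub_finite_set; exact: setDS.
have [|x [Kx clx]] := Kc F FF; first by rewrite /F /= setDv; exact: finite_set0.
have FKx : F (~` [set x]).
  by apply: sub_finite_set (finite_set1 x) => y [_] /contrapT.
by have [y [/= nyx yx]] := clx _ _ FKx (discrete_set1 x).
Qed.

Section representation.
Variables (R : realType) (G : preTopologicalGroupType) (H : hilbertType R).
Variable pi : unitary_rep G H.
Implicit Types (g h : G) (x y : H).

Lemma repD g x y : pi g (x + y) = pi g x + pi g y.
Proof. by have := rep_linear pi g 1 x y; rewrite !scale1r. Qed.

Lemma rep0 g : pi g 0 = 0.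
Proof. by apply: (addrI (pi g 0)); rewrite -repD !addr0. Qed.

Lemma repZ g (c : R[i]) x : pi g (c *: x) = c *: pi g x.
Proof. by have := rep_linear pi g c x 0; rewrite rep0 !addr0. Qed.

Lemma repN g x : pi g (- x) = - pi g x.
Proof. by rewrite -scaleN1r repZ scaleN1r. Qed.

Lemma repB g x y : pi g (x - y) = pi g x - pi g y.
Proof. by rewrite repD repN. Qed.

Lemma rep_rip g x y : rip (pi g x) (pi g y) = rip x y.
Proof. by rewrite /rip rep_inner. Qed.

Lemma rep_nrm g x : nrm (pi g x) = nrm x.
Proof. by apply/eqP; rewrite -(@eqrXn2 _ 2) ?nrm_ge0 // -!ripxx rep_rip. Qed.

Lemma repK g x : pi g^-1%g (pi g x) = x.
Proof. by rewrite -repM mulVg rep1. Qed.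

Lemma rep_ripV g x y : rip (pi g x) y = rip x (pi g^-1%g y).
Proof. by rewrite -(rep_rip g^-1%g) repK. Qed.

Definition invariant_in (A : set G) : set H := [set x | forall g, A g -> pi g x = x].

Lemma invariant_in_closed (A : set G) : nclosed (invariant_in A).
Proof.
move=> x xA g Ag; apply/eqP; rewrite -subr_eq0; apply/eqP/nrm0_eq0/le_anti.
rewrite nrm_ge0 andbT; apply/ler_addgt0Pr => e e0; rewrite add0r.
have [y yA xy] := xA (e / 2) (divr_gt0 e0 (ltr0n _ 2)).
rewrite -(subrKA y) -{1}(yA g Ag) -repB.
apply: le_trans (ler_nrmD _ _) _; rewrite rep_nrm nrmB (nrmB y).
by move: xy; rewrite nrmB; lra.
Qed.

Definition csub_inv (A : set G) : csub H.
Proof.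
exists (invariant_in A).
- by move=> g _; rewrite rep0.
- by move=> x y xA yA g Ag; rewrite repD xA ?yA.
- by move=> c x xA g Ag; rewrite repZ xA.
- exact: invariant_in_closed.
Defined.

End representation.

Section orthogonal.
Variables (R : realType) (H : hilbertType R).

Lemma rip_closed0 (w : H) : nclosed [set v | rip v w = 0].
Proof.
move=> x xw /=; apply/eqP; rewrite -normr_eq0 eq_le normr_ge0 andbT.
apply/ler_addgt0Pr => e e0; rewrite add0r.
have w0 : 0 < nrm w + 1 by rewrite ltr_wpDl ?nrm_ge0.
have [y /= yw xy] := xw (e / (nrm w + 1)) (divr_gt0 e0 w0).
have -> : rip x w = rip (x - y) w by rewrite ripDl ripNl yw oppr0 addr0.
apply: le_trans (_ : nrm (x - y) * nrm w <= _); last first.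
  move: xy; rewrite ltr_pdivlMr // => xy; apply: le_trans (ltW xy).
  by rewrite ler_wpM2l ?nrm_ge0 // lerDl.
(* Cauchy-Schwarz, read off from the square of the triangle inequality. *)
have CS (u v : H) : rip u v <= nrm u * nrm v.
  have := ler_nrmD u v; rewrite -ler_sqr ?nnegrE ?addr_ge0 ?nrm_ge0 //.
  by rewrite sqr_nrmD sqrrD; lra.
by rewrite ler_norml CS andbT lerNl -ripNl (le_trans (CS _ _)) // nrmN.
Qed.

(** Orthogonality for the real part suffices, because [W] is stable under complex scalars: a scalar
    [c] on the left moves to its conjugate on the right. *)
Definition csub_ortho (W : csub H) : csub H.
Proof.
exists [set v | forall w, W w -> rip v w = 0].
- by move=> w _; rewrite -(scale0r 0) (_ : 0 = 0%:C) // ripZl mul0r.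
- by move=> x y xW yW w Ww; rewrite ripDl xW ?yW ?addr0.
- move=> c x xW w Ww; rewrite /rip linearZl_LR /=.
  have := xW (Num.conj c *: w) (csubZ _ Ww).
  by rewrite /rip linearZr_LR /= conjCK.
- move=> x xW w Ww; apply: rip_closed0 => e e0.
  by have [y yW xy] := xW e e0; exists y => //; exact: yW.
Defined.

Lemma ortho_decomposition (W : csub H) (x : H) :
  exists p q, [/\ W p, csub_ortho W q & x = p + q].
Proof.
have [||||p Wp pP] := @projection _ _ W _ _ _ _ x.
- exact: csub0.
- exact: csubD.
- by move=> r y; exact: csubZ.
- exact: csub_closed.
by exists p, (x - p); split; rewrite // addrC subrK.
Qed.

Lemma ortho_disjoint (W : csub H) (x : H) : W x -> csub_ortho W x -> x = 0.
Proof.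
by move=> Wx /(_ _ Wx); rewrite ripxx => /eqP; rewrite sqrf_eq0 => /eqP/nrm0_eq0.
Qed.

End orthogonal.

(** The imaginary part of [<x, y>] is the real part of [<-i x, y>], so a linear map preserving real
    parts preserves the whole inner product. *)
Lemma rip_inner (R : realType) (H K : hilbertType R) (f : H -> K) :
  linear f -> (forall x y, rip (f x) (f y) = rip x y) ->
  forall x y, inner K (f x) (f y) = inner H x y.
Proof.
move=> lf frip x y; have fZ (c : R[i]) z : f (c *: z) = c *: f z.
  have f0 : f 0 = 0.
    have := lf 1 0 0; rewrite !scale1r addr0 => /eqP.
    by rewrite -subr_eq0 opprD addrA subrr add0r oppr_eq0 => /eqP.
  by have := lf c z 0; rewrite f0 !addr0.
apply/eqP; rewrite eq_complex; apply/andP; split; apply/eqP; first exact: frip.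
have := frip ((0 +i* -1) *: x) y; rewrite fZ /rip !linearZl_LR /=.
case: (inner K _ _) (inner H _ _) => [a b] [c d] /=.
by rewrite !mul0r !mulN1r !opprK !add0r.
Qed.

Section direct_sum.
Variables (R : realType) (G : discreteGroupType) (I : choiceType).
Variables (H : I -> hilbertType R) (V : forall i, csub (H i)).
Variables (pi : forall i, unitary_rep G (H i)).
Hypothesis piV : forall i g x, V i x -> V i (pi i g x).

Fact l2rep_summ g (f : l2sum V) : summ (fun i => nrm (pi i g (f i)) ^+ 2).
Proof. by under [X in summ X]funext do rewrite rep_nrm; exact: l2summ. Qed.

Definition l2rep_fun g (f : l2hilbert V) : l2hilbert V :=
  L2sum (fun i => piV g (l2sub f i)) (l2rep_summ g f).

Fact l2rep_linear g : linear (l2rep_fun g).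
Proof. by move=> c f h; apply: l2P => i; exact: rep_linear. Qed.

Definition l2rep : unitary_rep G (l2hilbert V).
Proof.
exists l2rep_fun.
- exact: l2rep_linear.
- move=> g; apply: rip_inner (l2rep_linear g) _ => x y.
  by congr ssum; apply/funext => i; rewrite /= rep_rip.
- by move=> f; apply: l2P => i; exact: rep1.
- by move=> g h f; apply: l2P => i; exact: repM.
- by move=> f; exact: discrete_continuous.
Defined.

End direct_sum.

Section kazhdan_pair.
Variables (R : realType) (G : preTopologicalGroupType).

Definition noninvariant_part (H : hilbertType R) (pi : unitary_rep G H) : csub H :=
  csub_ortho (csub_inv pi setT).

(** The quantitative form of property (T): one list and one constant serve every representation and
    every vector orthogonal to the invariants. *)
Definition spectral_gap (S : seq G) (eps : R) : Prop :=
  forall (H : hilbertType R) (pi : unitary_rep G H) q, noninvariant_part pi q ->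
  exists2 s, s \in S & eps * nrm q <= nrm (q - pi s q).

Lemma noninvariant_part_rep (H : hilbertType R) (pi : unitary_rep G H) g q :
  noninvariant_part pi q -> noninvariant_part pi (pi g q).
Proof.
move=> qn w wi; rewrite rep_ripV wi // qn //.
Qed.

End kazhdan_pair.

(** A counterexample to the gap, normalised and packed with its representation, so that one can be
    chosen for each finite list and all of them summed. *)
Record small_displacement (R : realType) (G : preTopologicalGroupType) (t : seq G)
    (eps : R) := SmallDisplacement {
  sd_space : hilbertType R;
  sd_rep : unitary_rep G sd_space;
  sd_vec : sd_space;
  sd_ortho : noninvariant_part sd_rep sd_vec;
  sd_unit : nrm sd_vec = 1;
  sd_small : forall s, s \in t -> nrm (sd_vec - sd_rep s sd_vec) < eps }.

Arguments sd_ortho {R G t eps} _ _ _.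

Lemma not_spectral_gap (R : realType) (G : preTopologicalGroupType) (t : seq G)
    (eps : R) : 1%g \in t -> ~ spectral_gap t eps ->
  inhabited (small_displacement t eps).
Proof.
move=> t1 /existsNP[H /existsNP[pi /existsNP[q /not_implyP[qn /forall2NP qt]]]].
have {}qt s : s \in t -> nrm (q - pi s q) < eps * nrm q.
  by case: (qt s) => // /negP; rewrite -ltNge.
(* At [s = 1] the strict inequality reads [0 < eps * nrm q]; this is why 1 is put in [t]. *)
have q0 : 0 < nrm q.
  rewrite lt_def nrm_ge0 andbT; apply/eqP => /nrm0_eq0 q0.
  by have := qt _ t1; rewrite q0 rep0 subr0 nrm0 mulr0 ltxx.
split; apply: (@SmallDisplacement _ _ _ _ _ pi ((nrm q)^-1%:C *: q)).
- exact: csubZ.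
- by rewrite nrmZ ger0_norm ?invr_ge0 ?nrm_ge0 // mulVf ?gt_eqF.
move=> s /qt; rewrite repZ -scalerBr nrmZ ger0_norm ?invr_ge0 ?nrm_ge0 //.
by rewrite ltr_pdivrMl // mulrC.
Qed.

Lemma property_T_spectral_gap (R : realType) (G : discreteGroupType) :
  has_property_T R G ->
  exists (S : seq G) (eps : R), [/\ 0 < eps, 1%g \in S & spectral_gap S eps].
Proof.
move=> GT; apply: contrapT => nogap.
pose e (t : seq G) : R := (size t).+1%:R^-1.
have ce t : small_displacement (1%g :: t) (e t).
  apply: inhabited_witness; apply: (not_spectral_gap (mem_head _ _)) => gap.
  apply: nogap; exists (1%g :: t), (e t); split=> //; first by rewrite invr_gt0.
  exact: mem_head.
pose V t := noninvariant_part (sd_rep (ce t)).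
pose pi := l2rep (fun t g x => @noninvariant_part_rep _ _ _ (sd_rep (ce t)) g x) .
have [K eps Kc eps0|xi xi1 xig] := GT (l2hilbert V) pi.
  have /finite_seqP[X KX] := compact_discrete_finite Kc.
  have [n ne] : exists n : nat, (n.+1%:R : R)^-1 < eps.
    by have [n] := ltr_add_invr eps0; rewrite add0r; exists n.
  (* Padding with copies of 1 lengthens the list until its tolerance [e t] drops below [eps]. *)
  pose t : seq G := X ++ nseq n 1%g.
  exists (l2delta (sd_ortho (ce t)) : l2hilbert V).
    rewrite nrmE (@nrm_supported_at _ _ _ _ t) ?l2deltaE ?sd_unit // => k kt.
    exact: l2deltaE0.
  move=> g Kg; rewrite nrmE ltcR (@nrm_supported_at _ _ _ _ t); last first.
    move=> k kt; rewrite [LHS]l2BE /= dfwithout 1?eq_sym // rep0 subr0 //.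
  rewrite [X in nrm X]l2BE /= dfwithin.
  apply: le_lt_trans (ltW (sd_small (ce t) _)) _.
    by rewrite inE mem_cat; apply/orP; right; apply/orP; left; move: Kg; rewrite KX.
  apply: le_lt_trans ne; rewrite lef_pV2 ?posrE //.
  by rewrite ler_nat ltnS size_cat size_nseq leq_addl.
(* Each coordinate of an invariant vector is invariant, but also lies in the complement of the
   invariants. *)
have xi0 : xi = 0.
  apply: l2P => t; apply: (@ortho_disjoint _ _ (csub_inv (sd_rep (ce t)) setT)).
    by move=> g _; have /(congr1 (fun f : l2hilbert V => f t)) := xig g.
  exact: l2sub.
by move: xi1; rewrite xi0 normr0 => /eqP; rewrite eq_sym oner_eq0.
Qed.

(** * Permutation representations on l2 of a set *)

Section permutation_representation.
Variables (R : realType) (G : preTopologicalGroupType) (X : choiceType).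
Variable a : G -> X -> X.
Hypothesis a1 : forall x, a 1%g x = x.
Hypothesis aM : forall g h x, a (g * h)%g x = a g (a h x).
Hypothesis a_locally_constant : forall g, \forall h \near g, forall x, a h x = a g x.

Definition l2X : hilbertType R := l2hilbert (fun _ : X => csubT (chilbert R)).

Let aK g : cancel (a g) (a g^-1%g).
Proof. by move=> x; rewrite -aM mulVg a1. Qed.

Let aVK g : cancel (a g^-1%g) (a g).
Proof. by move=> x; rewrite -aM mulgV a1. Qed.

Fact perm_rep_summ g (f : l2X) :
  summ (fun x => nrm (l2val f (a g^-1%g x)) ^+ 2).
Proof.
have [M fM] := l2summ f; exists M => s us.
rewrite -(big_map (a g^-1%g) xpredT (fun x => `|nrm (l2val f x) ^+ 2|)).
by apply: fM; rewrite map_inj_uniq //; exact: can_inj (aVK g).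
Qed.

Definition perm_rep_fun g (f : l2X) : l2X :=
  L2sum (V := fun _ : X => csubT (chilbert R))
    (fun x => l2sub f (a g^-1%g x)) (perm_rep_summ g f).

Fact perm_rep_linear g : linear (perm_rep_fun g).
Proof. by move=> c f h; exact: l2P. Qed.

Definition perm_rep : unitary_rep G l2X.
Proof.
exists perm_rep_fun.
- exact: perm_rep_linear.
- move=> g; apply: rip_inner (perm_rep_linear g) _ => x y.
  exact: (ssum_reindex (fun z => rip (l2val x z) (l2val y z)) (aVK g) (aK g)).
- by move=> f; apply: l2P => x /=; rewrite invg1 a1.
- by move=> g h f; apply: l2P => x /=; rewrite invgM aM.
- move=> f; apply: locally_constant_continuous => g.
  apply: filterS (a_locally_constant g) => h hg; apply: l2P => x /=.
  by congr (l2val f _); rewrite -{1}(aVK g x) -hg aK.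
Defined.

Definition l2dirac (x : X) : l2X := 
  @l2delta R X (fun=> chilbert R) (fun=> csubT (chilbert R)) x (1 : R[i]) I.

End permutation_representation.
Arguments l2dirac {R X} x.

(** * Finite generation and countability from a spectral gap *)

Section finite_generation.
Variables (R : realType) (G : discreteGroupType) (S : seq G) (eps : R).
Hypotheses (eps_gt0 : 0 < eps) (S_gap : spectral_gap S eps).

(** The group acts by left translation on its subsets, which hosts the coset space of the subgroup
    [D] generated by [S] without forming a quotient; [d] is the Dirac vector at [D]. *)
Lemma spectral_gap_generated : generated_by [set` S].
Proof.
pose a (g : G) (A : set G) : set G := [set z | A (g^-1 * z)%g].
have a1 A : a 1%g A = A by apply/funext => z; rewrite /a /= invg1 mul1g.
have aM g h A : a (g * h)%g A = a g (a h A).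
  by apply/funext => z; rewrite /a /= invgM mulgA.
have ac g : \forall h \near g, forall A, a h A = a g A.
  by apply: filterS (discrete_set1 g) => h ->.
pose pi := perm_rep R a1 aM ac.
pose D : set G := [set g | forall D : set G, D 1%g ->
  (forall s g, [set` S] s -> D g -> D (s * g)%g /\ D (s^-1 * g)%g) -> D g].
suff DT g : D g by move=> D' D1 D'S g; exact: DT.
have Ds s : s \in S -> a s D = D.
  move=> sS; apply/funext => z; apply/propext; split=> zD D' D1 D'S.
    by rewrite -[z](mulVKg s); apply: (D'S _ _ sS (zD D' D1 D'S)).1.
  by apply: (D'S _ _ sS (zD D' D1 D'S)).2.
pose d : l2X R (set G) := l2dirac D.
have [p [q [pi_ qn dpq]]] := ortho_decomposition (csub_inv pi setT) d.
have ds s : s \in S -> pi s d = d.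
  move=> sS; apply: l2P => A /=; have [->|AD] := eqVneq A D.
    suff -> : a s^-1%g D = D by [].
    by rewrite -{1}(Ds s sS) -aM mulVg a1.
  rewrite !dfwithout 1?eq_sym //; apply: contraNneq AD => DA.
  by rewrite -[A]a1 -(mulgV s) aM DA Ds.
(* Both [d] and its invariant part [p] are fixed by [S], hence so is [q], and the gap forces
   [q = 0]. So [d] is invariant, the translate of [D] by [g^-1] is [D], and [g] lies in [D] because
   1 does. *)
have [s sS] := S_gap qn.
have -> : pi s q = q.
  have -> : q = d - p by rewrite dpq addrC addKr.
  by rewrite repB ds // pi_.
rewrite subrr nrm0 => qle.
have {qle} q0 : q = 0.
  apply/nrm0_eq0/le_anti; rewrite nrm_ge0 andbT -(ler_pM2l eps_gt0) mulr0 //.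
have dg : pi g d = d by rewrite dpq q0 addr0 pi_.
have : l2val (pi g d) D = 1 by rewrite dg /= dfwithin.
rewrite /=; have [aD _|] := eqVneq (a g^-1%g D) D.
  have : a g^-1%g D 1%g by rewrite aD => D' D1 _.
  by rewrite /a /= invgK mulg1.
move=> aD; rewrite dfwithout 1?eq_sym // => /eqP.
by rewrite eq_sym (@oner_eq0 R[i]).
Qed.

End finite_generation.

(** Each element is evaluated from a word of pairs: a sign, true for a generator and false for an
    inverse, and a position in [S]. Such words are countable. *)
Lemma generated_countable (G : groupType) (S : seq G) : generated_by [set` S] ->
  exists idx : G -> nat, injective idx.
Proof.
move=> gen.
pose f := fix f (w : seq (bool * nat)) : G := if w is (b, i) :: w' then
  ((if b then nth 1 S i else (nth 1 S i)^-1) * f w')%g else 1%g.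
have /choice[w wE] : forall g : G, exists w, f w = g.
  apply: gen => [|s _ sS [w <-]]; first by exists [::].
  by split; [exists ((true, index s S) :: w) | exists ((false, index s S) :: w)];
    rewrite /= nth_index.
by exists (pickle \o w); apply: inj_comp; [exact: pcan_inj pickleK | exact: can_inj wE].
Qed.

(** * The topology of bounded functions *)

Lemma finite_set_bound (T : eqType) (A : set T) (h : T -> nat) : finite_set A ->
  exists N, forall a, A a -> (h a < N)%N.
Proof.
move=> /finite_seqP[s ->]; exists (\max_(a <- s) h a).+1 => a /= as_.
by rewrite ltnS; exact: leq_bigmax_seq.
Qed.

Section bfun_neighborhoods.
Variable G : discreteGroupType.
Implicit Types (x y f : bfun G) (h : G -> nat) (Q : set G).

Definition bnbhs h x : set (bfun G) :=
  [set f | forall n, f n = x n \/ (h (f n) <= n)%N].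

Lemma open_coord Q n (A : set G) : open [set f : power Q | A (set_val (f n))].
Proof.
apply: (@open_comp _ _ (fun f : power Q => f n) [set q | A (set_val q)]).
  by move=> f _; exact: proj_continuous.
exact: discrete_open.
Qed.

Lemma bfun_openP (U : set (bfun G)) :
  (forall Q (Qfin : finite_set Q), open (bfun_incl Qfin @^-1` U)) -> open U.
Proof.
move=> Uo; rewrite -[U]setCK openC; apply/closed_bfunE => Q Qfin.
by apply: open_closedC; exact: Uo.
Qed.

Lemma open_bfunP (U : set (bfun G)) : open U ->
  forall Q (Qfin : finite_set Q), open (bfun_incl Qfin @^-1` U).
Proof.
by rewrite -closedC => /closed_bfunE Uc Q Qfin; rewrite -closedC; exact: Uc.
Qed.

(** On [Q^N] with [Q] finite, [h] is bounded, so only finitely many coordinates are restricted and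
    the trace is open. *)
Lemma bnbhs_nbhs h x : nbhs x (bnbhs h x).
Proof.
apply: open_nbhs_nbhs; split; last by move=> n; left.
apply: bfun_openP => Q Qfin; have [N hN] := finite_set_bound h Qfin.
rewrite (_ : _ @^-1` _ = \bigcap_(n in `I_N)
    [set f : power Q | set_val (f n) = x n \/ (h (set_val (f n)) <= n)%N]).
  elim: N {hN} => [|N IH]; first by rewrite II0 bigcap_set0; exact: openT.
  rewrite IIS bigcap_setU bigcap_set1; apply: openI => //.
  have HN := @open_coord Q N [set g | g = x N \/ (h g <= N)%N].
  apply HN.
apply/seteqP; split=> f /= fh n; first by move=> _; exact: fh.
have [/fh//|Nn] := ltnP n N; right.
by rewrite ltnW // (leq_trans (hN _ (set_valP (f n)))).
Qed.

Lemma bfun_coord_locally_constant n x : \forall f \near x, (f : bfun G) n = x n.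
Proof.
by apply: filterS (bnbhs_nbhs (fun=> n.+1) x) => f /(_ n)[//|]; rewrite ltnn.
Qed.

Lemma power_compact Q : finite_set Q -> compact [set: power Q].
Proof.
move=> Qfin.
have := @tychonoff nat (fun=> discrete_topology Q) (fun=> setT).
rewrite (_ : [set f | _] = setT); last by apply/seteqP; split.
apply=> _; apply: finite_compact.
have vinj : injective (fun q : discrete_topology Q => set_val q) := val_inj.
have e : ((fun q : discrete_topology Q => set_val q : G) @` setT #=
    [set: discrete_topology Q])%card.
  by apply: inj_card_eq => p q _ _; exact: vinj.
rewrite -(eq_finite_set e); apply: sub_finite_set Qfin => _ [q _ <-].
exact: set_valP.
Qed.

Definition to_power Q f (fQ : forall n, Q (f n)) : power Q :=
  fun n => exist _ (f n) (mem_set (fQ n)).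

Lemma to_powerK Q (Qfin : finite_set Q) f (fQ : forall n, Q (f n)) :
  bfun_incl Qfin (to_power fQ) = f.
Proof. exact/bfun_val_inj. Qed.

(** A cluster point from compactness of [Q^N]; cylinders being open, each of its coordinates is
    attained by arbitrarily late terms. *)
Lemma power_cluster Q (Qfin : finite_set Q) (u : nat -> bfun G)
    (uQ : forall m n, Q (u m n)) : exists x : bfun G,
  (forall n k, exists2 m, (k <= m)%N & u m n = x n) /\
  forall U, open U -> U x -> forall k, exists2 m, (k <= m)%N & U (u m).
Proof.
pose v m := to_power (uQ m).
have [|p [_ pv]] := power_compact Qfin (F := v @ \oo) _; first exact: filterT.
have meet (U : set (power Q)) : open U -> U p ->
    forall k, exists2 m, (k <= m)%N & U (v m).
  move=> Uo Up k; have Fk : (v @ \oo) (v @` [set m | (k <= m)%N]).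
    by exists k => // m km; exists m.
  have [_ [[m km <-] Um]] := pv _ _ Fk (open_nbhs_nbhs (conj Uo Up)).
  by exists m.
exists (bfun_incl Qfin p); split=> [n k|U Uo Up k].
  have [||m km] := meet [set f : power Q | set_val (f n) = set_val (p n)] _ _ k.
  - have H := @open_coord Q n [set g | g = set_val (p n)].
    apply H.
  - by [].
  by exists m.
have [||m km Um] := meet (bfun_incl Qfin @^-1` U) _ _ k => //.
  exact: open_bfunP.
by exists m => //; rewrite /= to_powerK in Um.
Qed.

Section countable.
Variable idx : G -> nat.
Hypothesis idx_inj : injective idx.

Lemma finite_idx_lt k : finite_set [set g | (idx g < k)%N].
Proof.
have -> : [set g | (idx g < k)%N] = idx @^-1` `I_k by [].
by apply: finite_preimage => //; apply: in2W.
Qed.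

(** For an open [V] around [x], thresholds are chosen one group element at a time, so that functions
    deviating from [x] only through the first [k] elements, each from its threshold on, stay in [V].
    A function of finite range is reached at some finite [k]. *)
Lemma bfun_nbhsE x U : nbhs x U <-> exists h, bnbhs h x `<=` U.
Proof.
split=> [|[h hU]]; last exact: filterS hU (bnbhs_nbhs h x).
rewrite nbhsE => -[V [Vo Vx] VU].
pose P k (t : nat -> nat) := forall f, (forall n, f n = x n \/
  (idx (f n) < k)%N /\ (t (idx (f n)) <= n)%N) -> V f.
(* [t] records the thresholds of the first [k] elements of [G]; the threshold of
   the next one exists because [Q ^ nat] is compact. *)
have /choice[m mP] : forall kt : nat * (nat -> nat), exists m, P kt.1 kt.2 ->
    P kt.1.+1 (fun i => if i == kt.1 then m else kt.2 i).
  move=> [k t] /=; apply: contrapT => /forallNP nP.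
  have {}nP m : P k t /\ exists f, (forall n, f n = x n \/ (idx (f n) < k.+1)%N /\
      ((if idx (f n) == k then m else t (idx (f n))) <= n)%N) /\ ~ V f.
    have /not_implyP[Pkt /existsNP[f /not_implyP[h1 h2]]] := nP m.
    by split=> //; exists f.
  have Pkt := (nP 0%N).1.
  have /choice[u uP] : forall m, exists f, (forall n, f n = x n \/ (idx (f n) < k.+1)%N /\
      ((if idx (f n) == k then m else t (idx (f n))) <= n)%N) /\ ~ V f.
    by move=> m; exact: (nP m).2.
  pose Q := range x `|` [set g | (idx g < k.+1)%N].
  have Qfin : finite_set Q.
    by rewrite finite_setU; split; [exact: bfun_finite | exact: finite_idx_lt].
  have [m' n|y [yu yV]] := @power_cluster Q Qfin u.
    by have [->|[]] := (uP m').1 n; [left; exists n | right].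
  (* At [n] the cluster point agrees with some [u m'] with [m' > n], where a deviation through the
     element of index [k] is forbidden as it needs [m' <= n]. So [y] obeys the previous thresholds
     and lies in [V], though the [u m] clustering at it do not. *)
  have Vy : V y.
    apply: Pkt => n; have [m' nm <-] := yu n n.+1.
    have [->|[ik tn]] := (uP m').1 n; [by left | right].
    move: ik tn; rewrite ltnS leq_eqVlt; case: eqP => //= _ _ mn.
    by move: nm; rewrite ltnNge mn.
  by have [m' _] := yV V Vo Vy 0%N; exact: (uP m').2.
pose T := fix T k := if k is k'.+1 then
  (fun i => if i == k' then m (k', T k') else T k' i) else (fun=> 0%N).
have TP k : P k (T k).
  elim: k => [|k IH]; last exact: mP (k, T k) IH.
  move=> f fx; rewrite (_ : f = x) //; apply/bfun_val_inj/funext => n.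
  by have [|[]] := fx n.
have Tstable i k : (i < k)%N -> T k i = T i.+1 i.
  elim: k => // k IH; rewrite ltnS leq_eqVlt => /predU1P[->//|ik].
  by rewrite -IH //= ltn_eqF.
exists (fun g => T (idx g).+1 (idx g)) => f fx; apply: VU.
have [k kf] := finite_set_bound idx (bfun_finite f).
apply: (TP k) => n; have [->|le_n] := fx n; first by left.
by right; rewrite kf ?Tstable ?kf //; exists n.
Qed.

End countable.
End bfun_neighborhoods.

(** * Continuity of the group law, completeness and separability *)

Section bfun_topological_group.
Variables (G : discreteGroupType) (idx : G -> nat).
Hypothesis idx_inj : injective idx.
Implicit Types (x y f g : bfun G) (Q : set G).

Lemma bfun_nbhs_coord n x : nbhs x [set f | bfun_val f n = bfun_val x n].
Proof. exact: bfun_coord_locally_constant. Qed.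

Lemma bfun_power_compact Q : finite_set Q -> compact [set f : bfun G | forall n, Q (f n)].
Proof.
move=> Qfin; have -> : [set f : bfun G | forall n, Q (f n)] = bfun_incl Qfin @` setT.
  apply/seteqP; split=> [f fQ|_ [p _ <-] n]; last exact: set_valP.
  by exists (to_power fQ); rewrite // to_powerK.
apply: continuous_compact (power_compact Qfin).
apply: continuous_subspaceT; apply/continuousP => U Uo.
exact: open_bfunP.
Qed.

Lemma bfun_hausdorff : hausdorff_space (bfun G).
Proof.
move=> p q pq; apply/bfun_val_inj/funext => n.
by have [f [/= <- <-]] := pq _ _ (bfun_nbhs_coord n p) (bfun_nbhs_coord n q).
Qed.

Lemma finite_set_bounds (T : eqType) (A : G -> set T) (h : G -> T -> nat) :
  (forall a, finite_set (A a)) ->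
  exists N, forall a b, A a b -> (h a b <= N a)%N.
Proof.
move=> Afin; have /choice[N NP] : forall a, exists N, forall b, A a b -> (h a b <= N)%N.
  move=> a; have [N NP] := finite_set_bound (h a) (Afin a).
  by exists N => b /NP/ltnW.
by exists N.
Qed.

Lemma finite_idx_le (a : G) : finite_set [set b | (idx b <= idx a)%N].
Proof. exact: (finite_idx_lt idx_inj (idx a).+1). Qed.

(** Where both factors deviate, the one of smaller index is among finitely many elements determined
    by the other, so the threshold of the other can absorb it. Where one factor deviates, the other
    takes one of finitely many values. *)
Lemma bfun_is_topological_group : topological_group (bfun G).
Proof.
split=> [[x y] U /= /(bfun_nbhsE idx_inj)[h hU]|x U /(bfun_nbhsE idx_inj)[h hU]];
  last first.
  apply: filterS (bnbhs_nbhs (fun a => h a^-1%g) x) => f fx; apply: hU => n.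
  by have [e|] := fx n; [left; rewrite /= e | right].
pose A z (a : G) := range (bfun_val z) `|` [set b | (idx b <= idx a)%N].
have Afin z a : finite_set (A z a).
  by rewrite finite_setU; split; [exact: bfun_finite | exact: finite_idx_le].
have [h1 h1P] := finite_set_bounds (fun a b => h (a * b)%g) (Afin y).
have [h2 h2P] := finite_set_bounds (fun b a => h (a * b)%g) (Afin x).
exists (bnbhs h1 x, bnbhs h2 y).
  by split; exact: bnbhs_nbhs.
move=> [f g] [/= fx gy]; apply: hU => n /=.
have [ex|fn] := fx n; have [ey|gn] := gy n.
- by left; rewrite ex ey.
- by right; apply: leq_trans gn; apply: h2P; left; rewrite ex; exists n.
- by right; apply: leq_trans fn; apply: h1P; left; rewrite ey; exists n.
right; have [le|/ltnW le] := leqP (idx (g n)) (idx (f n)).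
  by apply: leq_trans fn; apply: h1P; right.
by apply: leq_trans gn; apply: h2P; right.
Qed.

(** Pairing a left entourage with the whole square on the right shows that it is two-sided. *)
Lemma left_cauchy (F : set_system (bfun G)) : ProperFilter F ->
  (F, F) --> @two_sided_uniformity (bfun G) ->
  forall U, nbhs (1%g : bfun G) U ->
  exists2 C, F C & forall f g, C f -> C g -> U (f^-1 * g)%g.
Proof.
move=> FF Fc U nU.
have [[A B] [/= FA FB] AB] :
    filter_prod F F [set fg : bfun G * bfun G | U (fg.1^-1 * fg.2)%g].
  apply: Fc; exists [set fg | U (fg.1^-1 * fg.2)%g], setT; split.
  - by exists U.
  - by exists setT => //; exact: filterT.
  - by rewrite setIT.
exists (A `&` B); first exact: filterI.
by move=> f g [Af _] [_ Bg]; exact: (AB (f, g)).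
Qed.

(** Each coordinate is eventually constant along a Cauchy filter, which defines [x]. The substance
    is that [x] has finite range; a well-chosen [h] defeats the opposite case. *)
Lemma bfun_complete : complete_group (bfun G).
Proof.
move=> F FF /(left_cauchy FF) Fc.
have /choice[x xF] : forall n, exists v, F [set f | bfun_val f n = v].
  move=> n; have [C FC CP] := Fc _ (bfun_nbhs_coord n 1%g).
  have [f Cf] := filter_ex FC; exists (f n); apply: filterS FC => g Cg.
  have /= e := CP f g Cf Cg.
  by rewrite /= -[LHS](mulVKg (f n)) e mulg1.
have near_x h : exists2 C, F C & forall f, C f ->
    forall n, ((f n)^-1 * x n = 1)%g \/ (h ((f n)^-1 * x n)%g <= n)%N.
  have [C FC CP] := Fc _ (bnbhs_nbhs h 1%g); exists C => // f Cf n.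
  have [g [Cg <-]] := filter_ex (filterI FC (xF n)).
  exact: CP f g Cf Cg n.
have xfin : finite_set (range x).
  apply: contrapT => xinf.
  have /choice[nu nuP] : forall v, exists n, range x v -> x n = v.
    by move=> v; have [[n _ <-]|] := pselect (range x v); [exists n | exists 0%N].
  (* If [f] has finite range then, for all but finitely many values [v = x n],
     [c = (f n)^-1 * v] is enumerated after [f n], so that [h c] exceeds [n = nu v]. *)
  have [h hP] := finite_set_bounds (fun c a => (nu (a * c)%g).+1) finite_idx_le.
  have [C FC CP] := near_x h; have [f Cf] := filter_ex FC.
  have [N NP] := finite_set_bound idx (bfun_finite f).
  pose B := (fun p => p.1 * p.2)%g @`
    (range f `*` ([set 1%g] `|` [set c | (idx c < N)%N])).
  have Bfin : finite_set B.
    apply: finite_image; apply: finite_setX; first exact: bfun_finite.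
    by rewrite finite_setU; split; [exact: finite_set1 | exact: finite_idx_lt].
  apply: xinf; apply: sub_finite_set Bfin => v xv.
  set n := nu v; have xn : x n = v by exact: nuP.
  exists (f n, (f n)^-1 * v)%g; last by rewrite /= mulVKg.
  split=> /=; first by exists n.
  have := CP f Cf n; rewrite xn => -[->|hn]; first by left.
  right => /=; rewrite ltnNge; apply/negP => Nle.
  have /hP : (idx (f n) <= idx ((f n)^-1 * v)%g)%N.
    by apply: leq_trans Nle; apply/ltnW/NP; exists n.
  by move=> /leq_trans/(_ hn); rewrite mulVKg ltnn.
exists (BFun xfin) => U /(bfun_nbhsE idx_inj)[h hU].
(* With [c = (f n)^-1 * x n] one has [f n = x n * c^-1], so [h'] bounds [h] uniformly over the
   finitely many values of [x]. *)
have [h' h'P] := finite_set_bounds (fun c v => h (v * c^-1)%g) (fun=> xfin).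
have [C FC CP] := near_x h'; apply: filterS FC => f Cf; apply: hU => n /=.
have [e|le_n] := CP f Cf n; first by left; rewrite -[RHS](mulVKg (f n)) e mulg1.
right; apply: leq_trans le_n; have /h'P : range x (x n) by exists n.
by move=> /(_ ((f n)^-1 * x n)%g); rewrite invgM invgK mulVKg.
Qed.

Fact bfun_of_seq_finite (s : seq G) : finite_set (range (nth 1%g s)).
Proof.
apply: (@sub_finite_set _ _ [set` 1%g :: s]) => // _ [n _ <-] /=.
rewrite inE; case: (ltnP n (size s)) => ns; first by rewrite mem_nth ?orbT.
by rewrite nth_default // eqxx.
Qed.

(** Functions equal to 1 from some point on are dense: [x] cut off at [h 1] stays in [bnbhs h x],
    since the value 1 is free from there on. *)
Lemma bfun_separable : separable_space (bfun G).
Proof.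
have /choice[inv invP] : forall n : nat, exists g : G, forall g' : G,
    idx g' = n -> g = g'.
  move=> n; have [[g <-]|ng] := pselect (exists g : G, idx g = n).
    by exists g => g' /idx_inj ->.
  by exists 1%g => g' e; case: ng; exists g'.
have invK (g : G) : inv (idx g) = g by exact: invP.
pose d k := BFun (bfun_of_seq_finite (map inv (odflt [::] (unpickle k)))).
exists (range d); first exact: (card_le_trans (card_image_le _ _) _).
move=> O [x Ox] Oo; have [h hO] : exists h, bnbhs h x `<=` O.
  by apply/(bfun_nbhsE idx_inj)/open_nbhs_nbhs.
pose s := [seq idx (x n) | n <- iota 0 (h 1%g)].
exists (d (pickle s)); split; last by exists (pickle s).
have dE : d (pickle s) = nth 1%g [seq inv i | i <- s] :> (nat -> G).
  by rewrite [LHS]/(nth _ _) pickleK.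
apply: hO => n; rewrite dE -map_comp.
have [nh|hn] := ltnP n (h 1%g).
  by left; rewrite (nth_map 0%N) ?size_iota // nth_iota //= invK.
by right; rewrite nth_default // size_map size_iota.
Qed.

End bfun_topological_group.

(** * Products of commuting representations *)

Section average.
Variables (R : realType) (H : hilbertType R).
Implicit Types (l : seq H) (C : set H).

Definition avg l : H := ((size l)%:R^-1)%:C *: \sum_(y <- l) y.

Definition avg_closed C := forall l, l != [::] -> (forall y, y \in l -> C y) -> C (avg l).

Lemma nrm_sum l : nrm (\sum_(y <- l) y) <= \sum_(y <- l) nrm y.
Proof.
elim: l => [|y l IH]; first by rewrite !big_nil nrm0.
by rewrite !big_cons; apply: le_trans (ler_nrmD _ _) _; rewrite lerD2l.
Qed.

Lemma avgB l (x : H) : l != [::] -> avg l - x = avg [seq y - x | y <- l].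
Proof.
move=> l0; have n0 : (size l)%:R != 0 :> R by rewrite pnatr_eq0 size_eq0.
rewrite /avg size_map big_map sumrB scalerBr; congr (_ - _).
rewrite big_const_seq count_predT iter_addr_0 -[x *+ _]scaler_nat scalerA.
by rewrite -(rmorph_nat (real_complex R)) -rmorphM /= mulVf // scale1r.
Qed.

Lemma nrm_avg l (e : R) :
  l != [::] -> (forall y, y \in l -> nrm y <= e) -> nrm (avg l) <= e.
Proof.
move=> l0 le; have n0 : 0 < (size l)%:R :> R by rewrite ltr0n lt0n size_eq0.
rewrite /avg nrmZ ger0_norm ?invr_ge0 ?(ltW n0) // ler_pdivrMl //.
apply: le_trans (nrm_sum _) _; rewrite big_seq.
apply: (@le_trans _ _ (\sum_(y <- l | y \in l) e)); first exact: ler_sum.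
by rewrite -big_seq big_const_seq count_predT iter_addr_0 mulr_natl.
Qed.

Lemma avg_closed_ball (x : H) (e : R) : avg_closed [set y | nrm (y - x) <= e].
Proof.
move=> l l0 le /=; rewrite avgB //; apply: nrm_avg; first by case: (l) l0.
by move=> _ /mapP[y yl ->]; exact: le.
Qed.

Lemma avg_closed_csub (V : csub H) : avg_closed V.
Proof.
move=> l _ lV; apply: csubZ; elim: l lV => [|y l IH] lV.
  by rewrite big_nil; exact: csub0.
rewrite big_cons; apply: csubD; first by apply: lV; rewrite inE eqxx.
by apply: IH => z zl; apply: lV; rewrite inE zl orbT.
Qed.

End average.

Section averaging_operator.
Variables (R : realType) (G : preTopologicalGroupType) (S : seq G) (eps : R).
Variable H : hilbertType R.
Implicit Types (rho : unitary_rep G H) (x y q : H).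

Definition mean rho x : H := avg [seq rho s x | s <- 1%g :: S].

Lemma meanE rho x :
  mean rho x = ((size S).+1%:R^-1)%:C *: (x + \sum_(s <- S) rho s x).
Proof. by rewrite /mean /avg /= size_map big_cons rep1 big_map. Qed.

Lemma meanD rho x y : mean rho (x + y) = mean rho x + mean rho y.
Proof.
rewrite !meanE -scalerDr; congr (_ *: _); rewrite addrACA; congr (_ + _).
by rewrite -big_split /=; apply: eq_bigr => s _; rewrite repD.
Qed.

Lemma mean_fixed rho x : (forall g, rho g x = x) -> mean rho x = x.
Proof.
move=> xi; rewrite meanE; under eq_bigr do rewrite xi.
rewrite big_const_seq count_predT iter_addr_0 -mulrS -[x *+ _]scaler_nat scalerA.
by rewrite -(rmorph_nat (real_complex R)) -rmorphM /= mulVf ?scale1r // pnatr_eq0.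
Qed.

Lemma nrm_mean rho x : nrm (mean rho x) <= nrm x.
Proof. by apply: nrm_avg => // _ /mapP[s _ ->]; rewrite rep_nrm. Qed.

Lemma mean_csub (V : csub H) rho x : (forall g, V (rho g x)) -> V (mean rho x).
Proof. by move=> Vx; apply: avg_closed_csub => // _ /mapP[s _ ->]. Qed.

Hypotheses (eps_gt0 : 0 < eps) (S_gap : spectral_gap S eps).

Let e1 := Num.min eps 1.
(** One term [s] moves [q] substantially, so [q] and its image add up to at most [2 - e1^2 / 4]
    times [nrm q]; dividing by the number of terms, with the others bounded trivially, gives this
    rate. Capping [eps] at 1 keeps it nonnegative. *)
Definition mean_rate : R := 1 - e1 ^+ 2 / (4 * (size S).+1%:R).

Let e1_gt0 : 0 < e1. Proof. by rewrite lt_min eps_gt0 ltr01. Qed.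
Let e1_le1 : e1 <= 1. Proof. by rewrite ge_min lexx orbT. Qed.

Lemma mean_rate_lt1 : mean_rate < 1.
Proof. by rewrite /mean_rate ltrBlDr ltrDl divr_gt0 // ?mulr_gt0 ?exprn_gt0. Qed.

Lemma mean_rate_ge0 : 0 <= mean_rate.
Proof.
have n0 : 1 <= (size S).+1%:R :> R by rewrite ler1n.
rewrite /mean_rate subr_ge0 ler_pdivrMr ?mulr_gt0 // mul1r.
have : e1 ^+ 2 <= 1 by rewrite expr_le1 // ltW.
lra.
Qed.

Lemma mean_contraction rho q : noninvariant_part rho q ->
  nrm (mean rho q) <= mean_rate * nrm q.
Proof.
move=> qn; have [s sS sq] := S_gap qn; rewrite meanE (big_rem s) //= addrA.
(* By the parallelogram law the squared norm of the sum is at most [4 - e1^2] times that of [q], and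
   [4 - e1^2 <= (2 - e1^2 / 4)^2]. *)
have half : nrm (q + rho s q) <= (2 - e1 ^+ 2 / 4) * nrm q.
  have c0 : 0 <= 2 - e1 ^+ 2 / 4.
    have : e1 ^+ 2 <= 1 by rewrite expr_le1 // ltW.
    lra.
  rewrite -ler_sqr ?nnegrE ?mulr_ge0 ?nrm_ge0 // sqr_nrmD rep_nrm.
  have := sqr_nrmB q (rho s q); rewrite rep_nrm.
  have : (e1 * nrm q) ^+ 2 <= nrm (q - rho s q) ^+ 2.
    rewrite ler_sqr ?nnegrE ?mulr_ge0 ?nrm_ge0 ?(ltW e1_gt0) //.
    by apply: le_trans sq; rewrite ler_wpM2r ?nrm_ge0 // ge_min lexx.
  have : 0 <= (e1 ^+ 2 * nrm q) ^+ 2 by exact: sqr_ge0.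
  rewrite !exprMn; move: (nrm _ ^+ 2) (rip _ _) (nrm q ^+ 2) (e1 ^+ 2) => a b c d.
  rewrite !expr2; lra.
have n0 : 0 < (size S).+1%:R :> R by [].
rewrite nrmZ ger0_norm ?invr_ge0 // ler_pdivrMl //.
apply: le_trans (ler_nrmD _ _) _.
have rest : nrm (\sum_(g <- rem s S) rho g q) <= ((size S).+1%:R - 2) * nrm q.
  rewrite -(big_map (fun g => rho g q) xpredT id); apply: le_trans (nrm_sum _) _.
  rewrite big_map; under eq_bigr do rewrite rep_nrm.
  rewrite big_const_seq count_predT iter_addr_0 size_rem // -[nrm q *+ _]mulr_natl.
  rewrite ler_wpM2r ?nrm_ge0 //.
  have : (0 < size S)%N by case: (S) sS.
  by case: (size S) => // n _; rewrite /= -!natr1; lra.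
apply: le_trans (lerD half rest) _; rewrite -mulrDl mulrA ler_wpM2r ?nrm_ge0 //.
rewrite le_eqVlt; apply/orP; left; apply/eqP; rewrite /mean_rate.
by move: (_%:R) n0 => n n0; field; rewrite gt_eqF.
Qed.

Section commuting.
Variables (I : eqType) (r : I -> unitary_rep G H).
Hypothesis rC : forall v w g h x, v != w -> r v g (r w h x) = r w h (r v g x).
Implicit Type vs : seq I.

Definition joint_invariant vs : csub H.
Proof.
exists [set x | forall v, v \in vs -> forall g, r v g x = x].
- by move=> v _ g; rewrite rep0.
- by move=> x y xi yi v vv g; rewrite repD xi ?yi.
- by move=> c x xi v vv g; rewrite repZ xi.
- move=> x xi v vv g; apply: (@invariant_in_closed _ _ _ (r v) setT x _ g Logic.I).
  by move=> e /xi[y yi xy]; exists y => // h _; exact: yi.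
Defined.

Definition mean_product vs x : H := foldr (fun v => mean (r v)) x vs.

Lemma joint_invariant_rep v vs g x : v \notin vs ->
  joint_invariant vs x -> joint_invariant vs (r v g x).
Proof.
move=> vvs xi w wvs h; have wv : w != v by apply: contraNneq vvs => <-.
by rewrite (rC h g x wv) (xi w wvs h).
Qed.

Lemma joint_invariant_ortho_rep v vs g x :
  csub_ortho (joint_invariant vs) x -> csub_ortho (joint_invariant vs) (r v g x).
Proof.
move=> xo w wi; rewrite rep_ripV; have [vvs|vvs] := boolP (v \in vs).
  by rewrite wi // xo.
by rewrite xo //; exact: joint_invariant_rep.
Qed.

Lemma mean_productD vs x y : mean_product vs (x + y) = mean_product vs x + mean_product vs y.
Proof. by elim: vs => //= v vs ->; rewrite meanD. Qed.

Lemma mean_product_fixed vs x : joint_invariant vs x -> mean_product vs x = x.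
Proof.
elim: vs => //= v vs IH xi; rewrite IH.
  by apply: mean_fixed; apply: xi; rewrite inE eqxx.
by move=> w wvs; apply: xi; rewrite inE wvs orbT.
Qed.

Lemma mean_product_ortho vs us x : csub_ortho (joint_invariant vs) x ->
  csub_ortho (joint_invariant vs) (mean_product us x).
Proof.
move=> xo; elim: us => //= u us IH.
by apply: (mean_csub (V := csub_ortho (joint_invariant vs))) => g; exact: joint_invariant_ortho_rep.
Qed.

(** Split [q] into [p], jointly invariant under [vs], and an orthogonal [t]. The averages of [vs]
    fix [p] and contract [t] by induction, while the average of [v] contracts [p]. The two images
    stay orthogonal, so the rate does not deteriorate. *)
Lemma mean_product_contraction vs q : uniq vs -> csub_ortho (joint_invariant vs) q ->
  nrm (mean_product vs q) <= mean_rate * nrm q.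
Proof.
elim: vs q => [|v vs IH] q.
  move=> _ qo; have : rip q q = 0 by apply: qo.
  rewrite ripxx => /eqP; rewrite sqrf_eq0 => /eqP/nrm0_eq0 ->.
  by rewrite nrm0 mulr0.
rewrite cons_uniq => /andP[vvs uvs] qo.
have [p [t [pK tK qE]]] := ortho_decomposition (joint_invariant vs) q.
(* The component [w1] of an [r v]-invariant [w] is again [r v]-invariant, because both summands are
   stable by commutation. It is thus invariant under [v :: vs], hence orthogonal to [q], and to
   [t]. *)
have pn : noninvariant_part (r v) p.
  move=> w wi; have [w1 [w2 [w1K w2K wE]]] := ortho_decomposition (joint_invariant vs) w.
  have w1v g : r v g w1 = w1.
    have e : r v g w1 - w1 = w2 - r v g w2.
      apply/eqP; rewrite subr_eq addrAC -[w2 + w1]addrC -wE eq_sym subr_eq eq_sym.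
      by rewrite -repD -wE wi.
    apply/eqP; rewrite -subr_eq0; apply/eqP.
    apply: (@ortho_disjoint _ _ (joint_invariant vs)).
      apply: csubD; [exact: joint_invariant_rep | exact: csubN].
    by rewrite e; apply: csubD => //; apply: csubN; exact: joint_invariant_ortho_rep.
  have -> : rip p w = rip p w1 by rewrite wE ripDr (ripC p w2) w2K // addr0.
  have -> : p = q - t by rewrite qE addrK.
  rewrite ripDl ripNl tK // oppr0 addr0 qo // => u.
  by rewrite inE => /predU1P[->//|]; exact: w1K.
have Tp := mean_product_fixed pK.
have Tt := IH t uvs tK.
rewrite qE /= mean_productD Tp meanD.
have orth : rip (mean (r v) p) (mean (r v) (mean_product vs t)) = 0.
  rewrite ripC; have : csub_ortho (joint_invariant vs) (mean (r v) (mean_product vs t)).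
    apply: (mean_csub (V := csub_ortho (joint_invariant vs))) => g.
    by apply: joint_invariant_ortho_rep; exact: mean_product_ortho.
  apply; apply: (mean_csub (V := joint_invariant vs)) => g.
  exact: joint_invariant_rep.
have rate0 := mean_rate_ge0.
rewrite -ler_sqr ?nnegrE ?mulr_ge0 ?nrm_ge0 // exprMn !sqr_nrmD orth mulr0 addr0.
rewrite (ripC p) tK // mulr0 addr0 mulrDr -!exprMn.
apply: lerD; rewrite ler_sqr ?nnegrE ?mulr_ge0 ?nrm_ge0 //.
  exact: mean_contraction.
exact: le_trans (nrm_mean _ _) Tt.
Qed.

Fixpoint product_orbit vs x : set H :=
  if vs is v :: vs' then
    [set y | exists s z, [/\ s \in 1%g :: S, product_orbit vs' x z & y = r v s z]]
  else [set x].

(** The product of averages is itself an average over the orbit; the induction pulls [C] back to the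
    vectors whose images under all [r v s] lie in [C]. *)
Lemma mean_product_hull vs x C : avg_closed C -> product_orbit vs x `<=` C ->
  C (mean_product vs x).
Proof.
elim: vs C => [|v vs IH] C Cavg; first by apply.
move=> xC /=; pose C' : set H := [set y | forall s, s \in 1%g :: S -> C (r v s y)].
have C'T : C' (mean_product vs x).
  apply: IH => [l l0 lC' s sS|y yo s sS]; last by apply: xC; exists s, y.
  rewrite /avg repZ (_ : r v s _ = \sum_(y <- [seq r v s y | y <- l]) y).
    rewrite -(size_map (r v s) l); apply: Cavg; first by case: (l) l0.
    by move=> _ /mapP[y yl ->]; exact: lC'.
  rewrite big_map; elim: (l) => [|y l' IHl]; first by rewrite !big_nil rep0.
  by rewrite !big_cons repD IHl.
by apply: Cavg => // _ /mapP[s sS ->]; exact: C'T.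
Qed.

(* The bound does not depend on the number of factors. *)
Lemma joint_invariant_close vs x (d : R) : uniq vs ->
  product_orbit vs x `<=` [set y | nrm (y - x) <= d] ->
  exists2 p, joint_invariant vs p & nrm (x - p) <= d / (1 - mean_rate).
Proof.
move=> uvs xd; have [p [q [pK qK xE]]] := ortho_decomposition (joint_invariant vs) x.
exists p => //; have -> : x - p = q by rewrite xE addrC addKr.
have r1 : 0 < 1 - mean_rate by rewrite subr_gt0 mean_rate_lt1.
have hull := mean_product_hull (avg_closed_ball (e := d)) xd.
rewrite ler_pdivlMr // mulrBr mulr1.
(* The averages fix [p], so they move [q] by at most [d]; as they also contract [q],
   [(1 - mean_rate) * nrm q <= d]. *)
have := hull; rewrite /= {1}xE mean_productD mean_product_fixed // xE opprD.
rewrite addrACA subrr add0r => Tq.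
have : nrm q <= nrm (q - mean_product vs q) + nrm (mean_product vs q).
  by apply: le_trans (ler_nrmD _ _); rewrite subrK.
have := mean_product_contraction uvs qK; rewrite nrmB; lra.
Qed.

End commuting.
End averaging_operator.

(** * The compact Kazhdan set *)

Section indicator.
Variable G : discreteGroupType.
Implicit Types (A : pred nat) (a b : G) (f : bfun G).

Fact bfun_on_finite A a : finite_set (range (fun n => if A n then a else 1%g)).
Proof.
apply: (@sub_finite_set _ _ [set a; 1%g]) => // _ [n _ <-].
by case: (A n); [left | right].
Qed.

Definition bfun_on A a : bfun G := BFun (bfun_on_finite A a).

Lemma bfun_on1 A : bfun_on A 1%g = 1%g.
Proof. by apply/bfun_val_inj/funext => n /=; case: (A n). Qed.

Lemma bfun_onM A a b : bfun_on A (a * b)%g = (bfun_on A a * bfun_on A b)%g.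
Proof. by apply/bfun_val_inj/funext => n /=; case: (A n); rewrite ?mulg1. Qed.

Lemma bfun_on_commute A B a b : (forall n, ~~ (A n && B n)) ->
  (bfun_on A a * bfun_on B b)%g = (bfun_on B b * bfun_on A a)%g.
Proof.
move=> AB; apply/bfun_val_inj/funext => n /=; have := AB n.
by case: (A n) (B n) => [] []; rewrite ?mulg1 ?mul1g.
Qed.

Variables (R : realType) (H : hilbertType R) (pi : unitary_rep (bfun G) H).

Definition rep_on A : unitary_rep G H.
Proof.
exists (fun a => pi (bfun_on A a)).
- by move=> a; exact: rep_linear.
- by move=> a x y; exact: rep_inner.
- by move=> x; rewrite bfun_on1 rep1.
- by move=> a b x; rewrite bfun_onM repM.
- by move=> x; exact: discrete_continuous.
Defined.

Definition level f (v : G) : pred nat := fun n => f n == v.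

Lemma rep_on_level_commute f v w a b x : v != w ->
  rep_on (level f v) a (rep_on (level f w) b x) =
  rep_on (level f w) b (rep_on (level f v) a x).
Proof.
move=> vw; rewrite /= -!repM bfun_on_commute // => n.
apply/negP => /andP[/eqP fv /eqP fw].
by rewrite -fv -fw eqxx in vw.
Qed.

Lemma bfun_values f : exists vs : seq G, uniq vs /\ forall n, f n \in vs.
Proof.
have /finite_seqP[s sE] := bfun_finite f; exists (undup s).
split=> [|n]; first exact: undup_uniq.
by rewrite mem_undup; have : range f (f n) by [exists n]; rewrite sE.
Qed.

(** [f] is the product, over its values [v], of the functions equal to [v] on the level set and to 1
    elsewhere. *)
Lemma fixed_by_levels f x (vs : seq G) : uniq vs -> (forall n, f n \in vs) ->
  (forall v, v \in vs -> rep_on (level f v) v x = x) -> pi f x = x.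
Proof.
move=> uvs fvs xv; suff [g [gE gx]] : exists g : bfun G,
    (forall n, g n = if f n \in vs then f n else 1%g) /\ pi g x = x.
  by rewrite (_ : f = g) //; apply/bfun_val_inj/funext => n; rewrite gE fvs.
elim: vs uvs xv {fvs} => [|v vs IH] /=.
  by exists 1%g; split=> [n|] //; rewrite rep1.
move=> /andP[vvs uvs] xv; have [|g [gE gx]] := IH uvs.
  by move=> w wvs; apply: xv; rewrite inE wvs orbT.
exists (bfun_on (level f v) v * g)%g; split=> [n|]; last first.
  by rewrite repM gx; apply: xv; rewrite inE eqxx.
rewrite /= gE inE /level; case: eqP => [->|_] /=; last by rewrite mul1g.
by rewrite (negbTE vvs) mulg1.
Qed.

(** One factor from [1 :: S] on each level set makes a single function with values in [1 :: S]. Its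
    triviality off the levels of [vs] lets the induction add a new level without mixing values. *)
Lemma product_orbit_levels f x (S : seq G) (vs : seq G) y : uniq vs ->
  product_orbit S (fun v => rep_on (level f v)) vs x y ->
  exists g : bfun G, [/\ y = pi g x, forall n, g n \in 1%g :: S &
    forall n, f n \notin vs -> g n = 1%g].
Proof.
elim: vs y => [|v vs IH] y /=.
  by move=> _ ->; exists 1%g; split=> [|n|//]; rewrite ?rep1 ?inE ?eqxx.
move=> /andP[vvs uvs] [s [z [sS /(IH _ uvs)[g [-> gS g1]] ->]]].
exists (bfun_on (level f v) s * g)%g; split=> [|n|n]; rewrite ?repM //=.
  rewrite /level; case: eqP => [fv|_]; last by rewrite mul1g.
  by rewrite g1 ?mulg1 // fv.
rewrite inE negb_or /level => /andP[/negbTE -> /g1 ->]; exact: mul1g.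
Qed.

End indicator.

Section kazhdan.
Variables (R : realType) (G : discreteGroupType) (S : seq G) (eps : R).
Hypotheses (eps_gt0 : 0 < eps) (S_gap : spectral_gap S eps).

Definition kazhdan_bfun : set (bfun G) := [set f | forall n, [set` 1%g :: S] (f n)].

Lemma kazhdan_bfun_compact : compact kazhdan_bfun.
Proof. exact: bfun_power_compact (finite_seq _). Qed.

Lemma kazhdan_bfun_kazhdan : kazhdan_set R kazhdan_bfun.
Proof.
pose c := 1 - mean_rate S eps.
have c0 : 0 < c by rewrite subr_gt0 mean_rate_lt1.
(* This tolerance puts [xi] within 1/4 of a vector fixed by [g], for every [g], so that the whole
   orbit of [xi] stays within 1/2 of it. *)
exists (c / 4) => [|H pi [xi xi1 xiK]]; first by rewrite divr_gt0.
have {}xi1 : nrm xi = 1 by apply: complexI; rewrite -nrmE xi1.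
have close g : nrm (pi g xi - xi) <= 2^-1.
  have [vs [uvs gvs]] := bfun_values g.
  have [|p pK pxi] := joint_invariant_close eps_gt0 S_gap
      (rep_on_level_commute pi g) (d := c / 4) (x := xi) uvs.
    move=> y /(product_orbit_levels uvs)[u [-> uS _]].
    by apply: ltW; rewrite -ltcR -nrmE -normrN opprB; exact: xiK.
  have gp : pi g p = p by apply: (fixed_by_levels uvs gvs) => v vvs; exact: pK.
  have -> : pi g xi - xi = pi g (xi - p) - (xi - p).
    by rewrite repB gp opprB addrA subrK.
  apply: le_trans (ler_nrmD _ _) _; rewrite nrmN rep_nrm.
  have : nrm (xi - p) <= 4^-1.
    apply: le_trans pxi _; rewrite -/c mulrAC mulfV ?mul1r // gt_eqF //.
  by lra.
(* [D] is invariant, convex and closed, so its unique element of least norm is invariant; being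
   within 1/2 of the unit vector [xi], it is nonzero. *)
pose D : set H := [set x | forall g, nrm (pi g x - xi) <= 2^-1].
have Dmid x y : D x -> D y -> D (2^-1%:C *: (x + y)).
  move=> Dx Dy g; rewrite repZ repD.
  have -> : 2^-1%:C *: (pi g x + pi g y) - xi =
      2^-1%:C *: ((pi g x - xi) + (pi g y - xi)).
    rewrite addrACA -opprD [RHS]scalerDr scalerN; congr (_ - _).
    rewrite -[in RHS](scale1r xi) -scalerDl scalerA -rmorphD -rmorphM /=.
    by rewrite (_ : 2^-1 * _ = 1) ?scale1r // mulVf.
  rewrite nrmZ ger0_norm ?invr_ge0 //.
  by have := ler_nrmD (pi g x - xi) (pi g y - xi); have := Dx g; have := Dy g; lra.
have Dcl : nclosed D.
  move=> x xD g; apply/ler_addgt0Pr => e e0; have [y Dy xy] := xD e e0.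
  rewrite -(subrKA (pi g y)) -repB; apply: le_trans (ler_nrmD _ _) _.
  by rewrite rep_nrm addrC lerD ?Dy // ltW.
have [v Dv vmin] := min_nrm (ex_intro _ xi close : D !=set0) Dmid Dcl.
have vinv g : pi g v = v.
  apply: (min_nrm_uniq Dmid) => // [h|u Du]; last by rewrite rep_nrm vmin.
  by rewrite -repM; exact: Dv.
have v0 : 0 < nrm v.
  have := Dv 1%g; rewrite rep1 => vxi; have := ler_nrmD v (xi - v).
  by rewrite addrCA subrr addr0 xi1 (nrmB xi); lra.
exists ((nrm v)^-1%:C *: v) => [|g]; last by rewrite repZ vinv.
by rewrite nrmE nrmZ ger0_norm ?invr_ge0 ?nrm_ge0 // mulVf ?gt_eqF.
Qed.

Lemma bfun_property_T : has_property_T R (bfun G).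
Proof.
have [e e0 ekaz] := kazhdan_bfun_kazhdan => H pi ai.
by apply: ekaz; apply: ai e0; exact: kazhdan_bfun_compact.
Qed.

End kazhdan.

(** * Finite subsets and finite-dimensional representations *)

Section no_finite_kazhdan.
Variables (R : realType) (G : discreteGroupType).
Hypothesis G_infinite : infinite_set [set: G].

(** Repeated pigeonhole: each function of finite range is constant on an infinite part of the
    infinite set kept so far. *)
Lemma finite_set_common_level (Q : set (bfun G)) : finite_set Q ->
  exists n m, n != m /\ forall f, Q f -> f n = f m.
Proof.
move=> /finite_seqP[s ->].
suff [A [Ainf As]] : exists A : set nat, infinite_set A /\
    forall f, f \in s -> forall n m, A n -> A m -> f n = f m.
  have [n An] := infinite_setN0 Ainf.
  have [m [Am mn]] : exists m, A m /\ m <> n.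
    apply: contrapT => /forallNP nA; apply: Ainf.
    apply: sub_finite_set (finite_set1 n) => m Am /=.
    by apply: contrapT => mn; exact: (nA m).
  exists n, m; split; first by apply/eqP => e; exact: mn.
  by move=> f fs; exact: As.
elim: s => [|f s [A [Ainf As]]].
  by exists setT; split=> //; exact: infinite_nat.
have [v vinf] : exists v, infinite_set (A `&` [set n | f n = v]).
  apply: contrapT => /forallNP nv; apply: Ainf.
  rewrite (_ : A = \bigcup_(v in range f) (A `&` [set n | f n = v])).
    apply: bigcup_finite => [|v _]; first exact: bfun_finite.
    by apply: contrapT; exact: nv v.
  apply/seteqP; split=> [n An|n [v _ []]//].
  by exists (f n); [exists n | split].
exists (A `&` [set n | f n = v]); split=> // g; rewrite inE => /predU1P[->|gs].
  by move=> n m [_ /= ->] [_ /= ->].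
by move=> n m [An _] [Am _]; exact: As.
Qed.

Lemma bfun_no_finite_kazhdan : ~ exists Q : set (bfun G), finite_set Q /\ kazhdan_set R Q.
Proof.
move=> [Q [/finite_set_common_level[n [m [nm Qnm]]] [eps eps0 kaz]]].
(* Left and right translation through two coordinates on which [Q] agrees. *)
pose a (f : bfun G) (x : G) : G := (f n * x * (f m)^-1)%g.
have a1 x : a 1%g x = x by rewrite /a /= invg1 mulg1 mul1g.
have aM f g x : a (f * g)%g x = a f (a g x) by rewrite /a /= invgM !mulgA.
have ac f : \forall g \near f, forall x, a g x = a f x.
  apply: filterS (filterI (bfun_nbhs_coord n f) (bfun_nbhs_coord m f)) => g [/= gn gm] x.
  by rewrite /a gn gm.
have [] := kaz _ (perm_rep R a1 aM ac).
  exists (l2dirac 1%g : l2X R G).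
    rewrite nrmE (@nrm_supported_at _ _ _ _ 1%g) => [|k k1]; last exact: l2deltaE0.
    by rewrite [X in nrm X]l2deltaE /nrm (@normr1 R[i]).
  move=> f Qf; rewrite (_ : perm_rep _ _ _ _ f _ = l2dirac 1%g).
    by rewrite subrr normr0 ltcR.
  apply: l2P => x /=; have [->|x1] := eqVneq x 1%g.
    by rewrite (_ : a f^-1%g 1%g = 1%g) // /a /= mulg1 (Qnm f Qf) mulgV.
  rewrite !dfwithout // 1?eq_sym //; apply: contraNneq x1 => e.
  by rewrite -[x]a1 -(mulgV f) aM e /a mulg1 (Qnm f Qf) mulgV.
move=> xi xi1 xii.
(* [g] is [x^-1] at [n] and 1 at [m], so its inverse moves 1 to [x], and an invariant vector is
   constant. *)
have const x : l2val xi x = l2val xi 1%g.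
  pose g := bfun_on (fun k => k == n) x^-1%g.
  have := congr1 (fun f : l2X R G => l2val f 1%g) (xii g).
  rewrite /= /a /= eqxx eq_sym (negbTE nm) !invg1 !mulg1 => <-.
  by rewrite invgK.
have [x0|x0] := eqVneq (l2val xi 1%g) 0.
  move: xi1; rewrite (_ : xi = 0) ?normr0; last by apply: l2P => x; rewrite const x0.
  by move/eqP; rewrite eq_sym oner_eq0.
have [M xiM] := l2summ xi.
pose c := nrm (l2val xi 1%g) ^+ 2.
have c0 : 0 < c.
  rewrite exprn_gt0 // lt_def nrm_ge0 andbT; apply: contraNneq x0 => /nrm0_eq0 ->.
  by [].
(* More than [M / c] points, each contributing [c], exceed the bound [M]. *)
have [B _ Bsize] := infinite_set_fset (Num.bound (M / c)) G_infinite.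
have := xiM _ (finmap.fset_uniq B); apply/negP; rewrite -ltNge.
under eq_bigr do rewrite const ger0_norm ?sqr_ge0 //.
rewrite big_const_seq count_predT iter_addr_0 -/c -[c *+ _]mulr_natl -ltr_pdivrMr //.
by apply: lt_le_trans (unstable.ltr_bound _) _; rewrite ler_nat.
Qed.

End no_finite_kazhdan.

(** A spanning family of least length is free: a nontrivial relation would let one of its vectors be
    dropped. *)
Lemma finite_dimensional_basis (R : realType) (H : hilbertType R) :
  finite_dimensional H -> exists n (e : 'I_n -> H),
    (forall x, exists c : 'I_n -> R[i], x = \sum_i c i *: e i) /\
    (forall c : 'I_n -> R[i], \sum_i c i *: e i = 0 -> forall i, c i = 0).
Proof.
pose spans n (e : 'I_n -> H) := forall x : H,
  exists c : 'I_n -> R[i], x = \sum_i c i *: e i.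
move=> [n0 [e0 span0]].
have exP : exists n, `[< exists e : 'I_n -> H, spans n e >].
  by exists n0; apply/asboolP; exists e0.
case: (ex_minnP exP) => n /asboolP[e espan] nmin; exists n, e; split=> // c c0 i.
apply: contrapT => /eqP ci; case: n e espan nmin c c0 i ci => [|n] e espan nmin c c0 i ci.
  by case: i ci.
suff /nmin : `[< exists e : 'I_n -> H, spans n e >] by rewrite ltnn.
apply/asboolP; exists (e \o lift i) => x; have [d ->] := espan x.
pose d' k := d k - d i / c i * c k; exists (d' \o lift i).
have -> : \sum_k d k *: e k = \sum_k d' k *: e k.
  transitivity (\sum_k d k *: e k - (d i / c i) *: \sum_k c k *: e k).
    by rewrite c0 scaler0 subr0.
  rewrite scaler_sumr -sumrB; apply: eq_bigr => k _.
  by rewrite scalerBl scalerA.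
by rewrite (bigD1_ord i) //= /d' divfK // subrr scale0r add0r.
Qed.

Lemma simple_finite_dimensional_trivial (R : realType) (G : discreteGroupType)
    (S : seq G) (H : hilbertType R) (rho : unitary_rep G H) :
  infinite_set [set: G] -> simple_group G -> generated_by [set` S] ->
  finite_dimensional H -> forall g x, rho g x = x.
Proof.
move=> Ginf Gsimple gen /finite_dimensional_basis[n [e [espan efree]]].
have coord_inj (c d : 'I_n -> R[i]) :
    \sum_i c i *: e i = \sum_i d i *: e i -> forall i, c i = d i.
  move=> cd i; apply/eqP; rewrite -subr_eq0; apply/eqP.
  apply: (efree (fun i => c i - d i)).
  by under eq_bigr do rewrite scalerBl; rewrite sumrB cd subrr.
have rep_sum g (c : 'I_n -> R[i]) (u : 'I_n -> H) :
    rho g (\sum_i c i *: u i) = \sum_i c i *: rho g (u i).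
  elim/big_rec2: _ => [|i y z _ <-]; first exact: rep0.
  by rewrite repD repZ.
have /choice[A AE] : forall g, exists A : 'M[R[i]]_n,
    forall i, rho g (e i) = \sum_j A j i *: e j.
  move=> g; have /choice[c cE] : forall i, exists c : 'I_n -> R[i],
      rho g (e i) = \sum_j c j *: e j by move=> i; exact: espan.
  exists (\matrix_(j, i) c i j) => i; rewrite cE.
  by apply: eq_bigr => j _; rewrite mxE.
have A1 g : A g = 1%:M -> forall x, rho g x = x.
  move=> Ag x; have [c ->] := espan x; rewrite rep_sum; apply: eq_bigr => i _.
  rewrite AE Ag (bigD1 i) //= mxE eqxx scale1r big1 ?addr0 // => j ji.
  by rewrite mxE (negbTE ji) scale0r.
move=> g; apply: A1; move: g; apply: (simple_linear_trivial Ginf Gsimple gen).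
  apply/matrixP => i j; move: i; apply: coord_inj; rewrite -AE rep1.
  rewrite (bigD1 j) //= mxE eqxx scale1r big1 ?addr0 // => k kj.
  by rewrite mxE (negbTE kj) scale0r.
move=> g h; apply/matrixP => i j; move: i; apply: coord_inj.
rewrite -AE repM AE rep_sum.
under eq_bigr do rewrite AE scaler_sumr.
rewrite exchange_big; apply: eq_bigr => i _.
rewrite mxE scaler_suml; apply: eq_bigr => k _.
by rewrite scalerA mulrC.
Qed.

(** Restricted to the copy of the group carried by a level set of [f], the representation is
    trivial; [f] is a product of elements of these copies. *)
Lemma bfun_minimally_almost_periodic (R : realType) (G : discreteGroupType) (S : seq G) :
  infinite_set [set: G] -> simple_group G -> generated_by [set` S] ->
  minimally_almost_periodic R (bfun G).
Proof.
move=> Ginf Gsimple gen H pi Hfin f x; have [vs [uvs fvs]] := bfun_values f.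
apply: (fixed_by_levels uvs fvs) => v _.
exact: simple_finite_dimensional_trivial Ginf Gsimple gen Hfin v x.
Qed.

Theorem mainTheorem11 (R : realType) (Gamma : discreteGroupType)
    (Gamma_infinite : infinite_set [set: Gamma])
    (Gamma_simple : simple_group Gamma)
    (Gamma_T : has_property_T R Gamma) :
  (topological_group (bfun Gamma) /\ hausdorff_space (bfun Gamma)) /\
  [/\ complete_group (bfun Gamma),
      separable_space (bfun Gamma),
      minimally_almost_periodic R (bfun Gamma),
      has_property_T R (bfun Gamma) /\
        (exists K : set (bfun Gamma), compact K /\ kazhdan_set R K) &
      ~ exists Q : set (bfun Gamma), finite_set Q /\ kazhdan_set R Q].
Proof.
(* The gap yields generation by [S], hence an enumeration [idx] on which the description of the
   topology rests. *)
have [S [eps [eps0 _ gap]]] := property_T_spectral_gap Gamma_T.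
have gen := spectral_gap_generated eps0 gap.
have [idx idx_inj] := generated_countable gen.
split; first by split; [exact: bfun_is_topological_group idx_inj | exact: bfun_hausdorff].
split.
- exact: bfun_complete idx_inj.
- exact: bfun_separable idx_inj.
- exact: bfun_minimally_almost_periodic Gamma_infinite Gamma_simple gen.
- split; first exact: bfun_property_T eps0 gap.
  exists (kazhdan_bfun S); split; first exact: kazhdan_bfun_compact.
  exact: kazhdan_bfun_kazhdan eps0 gap.
- exact: bfun_no_finite_kazhdan.
Qed.
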